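(* For every $S=2^{\omega((\log\log n)^2)}$ and every $\varepsilon>0$ there is a PRG with seed length $2^{O(\sqrt{\log S})}\log(1/\varepsilon)$ that $\varepsilon$-fools the class of $n$-variable $S$-sparse $\mathbb{F}_2$ polynomials. (The constant in $O(\cdot)$ is absolute.)
   Context: An $S$-sparse $\mathbb{F}_2$ polynomial is a polynomial over $\mathbb{F}_2$ in variables $x_1,\dots,x_n$ with at most $S$ monomials, viewed as a function $\{0,1\}^n\to\{0,1\}$. For $r<n$, a distribution $\mathcal{D}$ over $\{0,1\}^n$ can be sampled efficiently with $r$ random bits if it is the uniform distribution over a multiset of $s$ strings with $s\in[2^r/\mathrm{poly}(n),2^r]$ and there is a deterministic algorithm $\mathrm{Gen}$ which, given a uniform element of $[s]$, runs in time $\mathrm{poly}(n,s)$ and outputs a sample of $\mathcal{D}$. A PRG with seed length $r$ that $\varepsilon$-fools a class $\mathscr{C}$ is such a generator $\mathrm{Gen}$ with $|\mathbf{E}_{\mathbf{s}\leftarrow\{0,1\}^r}[f(\mathrm{Gen}(\mathbf{s}))]-\mathbf{E}_{\mathbf{x}\leftarrow\{0,1\}^n}[f(\mathbf{x})]|\le\varepsilon$ for every $f\in\mathscr{C}$.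
   Formalization: The factor log(1/ε) is read as max(1, log2(1/ε)), since the literal seed length forces r = 0 as ε approaches 1, where the claim fails; and r < n is not required, since it is impossible e.g. for S = 2^n and ε = 1/4. *)

(* Defs.v *)
From HB Require Import structures.
From mathcomp Require Import all_boot all_order all_algebra.
From mathcomp Require Import all_classical all_reals all_analysis.
(* Not imported: the notations of mpoly clash with those of analysis. *)
From mathcomp Require mpoly.

Set Implicit Arguments.
Unset Strict Implicit.
Unset Printing Implicit Defensive.

Import Order.TTheory GRing.Theory Num.Theory.

Local Open Scope classical_set_scope.
Local Open Scope ring_scope.

(** * Sparse polynomials over F_2 *)

(* [bitstring n] is {0,1}^n. *)
Notation bitstring n := (n.-tuple bool).

(* [msupp p] is the duplicate-free list of monomials of [p].  The
   representing polynomial need not be multilinear; as x ^+ 2 = x on F_2,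
   reducing exponents never increases the number of monomials, so this does
   not change the class of functions. *)
Definition sparse_F2_poly (n S : nat) (f : bitstring n -> bool) : Prop :=
  exists p : mpoly.mpoly n 'F_2,
    (size (mpoly.msupp p) <= S)%N /\
    forall x : bitstring n,
      (f x)%:R = mpoly.meval (fun i => (tnth x i)%:R : 'F_2) p.

(** * Fooling *)

Definition uniform_expectation (R : realType) (T : finType) (f : T -> bool) : R :=
  (\sum_(x : T) (f x)%:R) / #|T|%:R.

Definition fools (R : realType) (n r : nat) (eps : R)
    (C : (bitstring n -> bool) -> Prop) (G : bitstring r -> bitstring n) : Prop :=
  forall f, C f ->
    `| uniform_expectation R (fun s => f (G s)) - uniform_expectation R f | <= eps.

(** * Algorithms and running time *)

(* Structured programs for a random access machine.  There are unboundedly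
   many registers and memory cells holding natural numbers, but a program
   mentions only finitely many registers.  Every instruction and every test
   has unit cost.  As the only arithmetic is addition and truncated
   subtraction, the bit length of the numbers grows by at most one per step, so
   that this model is polynomially equivalent to Turing machines. *)
Inductive cmd : Type :=
| Const of nat & nat          (* Const x k   : x := k      *)
| Add of nat & nat & nat      (* Add x y z   : x := y + z  *)
| Sub of nat & nat & nat      (* Sub x y z   : x := y - z  *)
| Read of nat & nat           (* Read x y    : x := mem[y] *)
| Write of nat & nat          (* Write x y   : mem[x] := y *)
| Seq of cmd & cmd
| If of nat & cmd & cmd       (* If x c1 c2  : if x != 0 then c1 else c2 *)
| While of nat & cmd.         (* While x c   : while x != 0 do c *)

Record state : Type := State { reg : nat -> nat; mem : nat -> nat }.

Definition update (f : nat -> nat) (a v : nat) : nat -> nat :=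
  fun b => if b == a then v else f b.

Definition set_reg (st : state) (x v : nat) : state :=
  State (update (reg st) x v) (mem st).

Definition set_mem (st : state) (a v : nat) : state :=
  State (reg st) (update (mem st) a v).

(* [exec c st t st'] : started in [st], the program [c] halts after exactly
   [t] steps in [st']. *)
Inductive exec : cmd -> state -> nat -> state -> Prop :=
| exec_Const x k st : exec (Const x k) st 1 (set_reg st x k)
| exec_Add x y z st :
    exec (Add x y z) st 1 (set_reg st x (reg st y + reg st z)%N)
| exec_Sub x y z st :
    exec (Sub x y z) st 1 (set_reg st x (reg st y - reg st z)%N)
| exec_Read x y st : exec (Read x y) st 1 (set_reg st x (mem st (reg st y)))
| exec_Write x y st : exec (Write x y) st 1 (set_mem st (reg st x) (reg st y))
| exec_Seq c1 c2 st1 st2 st3 t1 t2 :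
    exec c1 st1 t1 st2 -> exec c2 st2 t2 st3 ->
    exec (Seq c1 c2) st1 (t1 + t2)%N st3
| exec_IfT x c1 c2 st t st' :
    reg st x != 0%N -> exec c1 st t st' -> exec (If x c1 c2) st t.+1 st'
| exec_IfF x c1 c2 st t st' :
    reg st x = 0%N -> exec c2 st t st' -> exec (If x c1 c2) st t.+1 st'
| exec_WhileT x c st1 st2 st3 t1 t2 :
    reg st1 x != 0%N -> exec c st1 t1 st2 -> exec (While x c) st2 t2 st3 ->
    exec (While x c) st1 (t1 + t2).+1 st3
| exec_WhileF x c st : reg st x = 0%N -> exec (While x c) st 1 st.

(* Initially register 0 holds the output length [n], register 1 the seed
   length [r], memory cells 0, ..., r-1 the seed, and all else is 0. *)
Definition initial_state (n r : nat) (s : bitstring r) : state :=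
  State (fun x => if x == 0%N then n else if x == 1%N then r else 0%N)
        (fun a => nat_of_bool (nth false s a)).

Definition holds_output (n : nat) (st : state) (y : bitstring n) : Prop :=
  forall i : 'I_n, mem st i = nat_of_bool (tnth y i).

(* One program serves all [n], in time polynomial in [n] and the number
   [2 ^ r n] of seeds. *)
Definition efficient_generator (r : nat -> nat)
    (Gen : forall n, bitstring (r n) -> bitstring n) : Prop :=
  exists (M : cmd) (c : nat), forall (n : nat) (s : bitstring (r n)),
    exists (t : nat) (st : state),
      [/\ exec M (initial_state n s) t st,
          (t <= c * (n + 2 ^ r n) ^ c)%N
        & holds_output st (Gen n s)].

(** * Asymptotics *)

Definition log2 (R : realType) (x : R) : R := ln x / ln 2.

(* The factor log(1/eps) of a seed length, with the usual convention that it is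
   at least 1.  It equals log2(1/eps) when eps <= 1/2; without the convention,
   a seed length proportional to it would be forced to 0 as eps approaches 1
   and would be negative for eps > 1. *)
Definition log_inv (R : realType) (eps : R) : R := Num.max 1 (log2 eps^-1).

(* f = omega(g) *)
Definition little_omega (R : realType) (f g : nat -> R) : Prop :=
  forall K : R, 0 < K -> \forall n \near \oo, K * `|g n| <= `|f n|.

(* Main.v *)
(* Viola's theorem: the sum of d independent small-bias strings fools F_2
   polynomials of degree d.  Its proof only uses that a polynomial of degree d
   has derivatives of degree d - 1: if (-1)^p is biased, it is a scaled average
   of such derivatives, and otherwise Cauchy-Schwarz in one of the d strings
   reduces the claim to Parseval's identity.

   An S-sparse polynomial is reduced to low degree by hashing the coordinates
   into 2^O(k) buckets, k = sqrt(log S), and replacing the uniform bits of one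
   bucket after another by a sum of small-bias strings.  Fix everything outside
   one bucket.  A union bound over all q-tuples of monomials shows that, except
   with probability eps / 2^O(k), no q surviving monomials contain together
   t = q (k + 1) variables of the bucket, where q ~ log(1/eps).  A greedy choice
   then yields fewer than t variables whose removal leaves degree at most k, and
   a function of these t variables costs only a factor 2^t in the error of
   Viola's theorem.  This factor 2^t = 2^O(k log(1/eps)) keeps the seed length
   linear in log(1/eps).

   The small-bias strings are sums of independent strings of bias 13/16, built
   from random linear forms on the binary digits of the index, as in the
   isolation lemma of Valiant and Vazirani. *)
Require Import Defs.
From HB Require Import structures.
From mathcomp Require Import all_boot all_order all_algebra.
From mathcomp Require Import ring lra zify.
From mathcomp Require boolp mpoly.

Set Implicit Arguments.
Unset Strict Implicit.
Unset Printing Implicit Defensive.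

Import Order.TTheory GRing.Theory Num.Theory.

(** The lower bound on [S] is needed by the base generator. Its linear forms act on vectors of M >=
    log n + 3 bits, and a seed of length 2^O(k) has room for them only because log log n < k. The
    hash uses the same source: each of the 10 k bits of a bucket number is a coordinate of a
    small-bias block, so t given variables fall into a given bucket with probability about 2^-(10 k
    t), which beats every union bound. A q-tuple of monomials may involve far too many variables for
    a union bound over their t-subsets. Then most of these variables lie outside the bucket, and
    there it is survival that is unlikely. As [S] and [eps] are arbitrary functions, no program can
    compute the parameters from n. The seed length r = 64^(10 k) Q with Q odd encodes them, and the
    program decodes r. If this length is not below n, the seed itself is the output. *)

(** * Uniform expectations over finite types *)

Section Expectation.
Local Open Scope ring_scope.
Variable R : realFieldType.

Definition Ex (T : finType) (F : T -> R) : R := (\sum_x F x) / #|T|%:R.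

Lemma eq_Ex (T : finType) (F G : T -> R) : F =1 G -> Ex F = Ex G.
Proof. by move=> FG; rewrite /Ex (eq_bigr G). Qed.

Lemma ExD (T : finType) (F G : T -> R) : Ex (fun x => F x + G x) = Ex F + Ex G.
Proof. by rewrite /Ex big_split mulrDl. Qed.

Lemma ExZ (T : finType) (a : R) (F : T -> R) : Ex (fun x => a * F x) = a * Ex F.
Proof. by rewrite /Ex -mulr_sumr mulrA. Qed.

Lemma ExZr (T : finType) (a : R) (F : T -> R) : Ex (fun x => F x * a) = Ex F * a.
Proof. by rewrite mulrC -ExZ; apply: eq_Ex => x; rewrite mulrC. Qed.

Lemma ExB (T : finType) (F G : T -> R) : Ex (fun x => F x - G x) = Ex F - Ex G.
Proof. by rewrite /Ex sumrB mulrBl. Qed.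

Lemma Ex_sum (T : finType) J (r : seq J) (P : pred J) (F : J -> T -> R) :
  Ex (fun x => \sum_(j <- r | P j) F j x) = \sum_(j <- r | P j) Ex (F j).
Proof. by rewrite /Ex exchange_big /= mulr_suml. Qed.

Lemma Ex_const (T : finType) (a : R) : (0 < #|T|)%N -> Ex (fun _ : T => a) = a.
Proof.
move=> T0; rewrite /Ex sumr_const -[X in X / _]mulr_natr mulfK //.
by rewrite pnatr_eq0 -lt0n.
Qed.

Lemma ler_Ex (T : finType) (F G : T -> R) : (forall x, F x <= G x) -> Ex F <= Ex G.
Proof. by move=> FG; rewrite ler_wpM2r ?invr_ge0 ?ler0n // ler_sum. Qed.

Lemma Ex_ge0 (T : finType) (F : T -> R) : (forall x, 0 <= F x) -> 0 <= Ex F.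
Proof. by move=> FG; rewrite mulr_ge0 ?invr_ge0 ?ler0n // sumr_ge0. Qed.

Lemma norm_Ex (T : finType) (F : T -> R) : `|Ex F| <= Ex (fun x => `|F x|).
Proof.
rewrite normrM [`|_^-1|]ger0_norm ?invr_ge0 ?ler0n //.
by rewrite ler_wpM2r ?invr_ge0 ?ler0n // ler_norm_sum.
Qed.

Lemma norm_Ex_le (T : finType) (F : T -> R) (a : R) :
  (0 < #|T|)%N -> (forall x, `|F x| <= a) -> `|Ex F| <= a.
Proof.
move=> T0 Fa; apply: le_trans (norm_Ex F) _.
by rewrite -[leRHS](Ex_const a T0); apply: ler_Ex.
Qed.

Lemma Ex_swap (T U : finType) (F : T -> U -> R) :
  Ex (fun x => Ex (F x)) = Ex (fun y => Ex (F^~ y)).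
Proof.
rewrite /Ex -!mulr_suml exchange_big /= -!mulrA; congr (_ * _); exact: mulrC.
Qed.

Lemma Ex_pair (T U : finType) (F : T * U -> R) :
  Ex F = Ex (fun x => Ex (fun y => F (x, y))).
Proof.
rewrite /Ex -mulr_suml pair_big /= card_prod natrM invfM mulrA [X in _ = X]mulrAC.
by congr (_ * _ * _); apply: eq_bigr => -[].
Qed.

Lemma Ex_bij (T U : finType) (h : T -> U) (F : U -> R) :
  bijective h -> Ex (fun x => F (h x)) = Ex F.
Proof.
move=> bh; rewrite /Ex (bij_eq_card bh); congr (_ / _).
by rewrite [RHS](reindex h) //; apply: onW_bij.
Qed.

Lemma sqr_Ex (T : finType) (F : T -> R) :
  (0 < #|T|)%N -> Ex F ^+ 2 <= Ex (fun x => F x ^+ 2).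
Proof.
move=> T0; rewrite -subr_ge0.
have -> : Ex (fun x => F x ^+ 2) - Ex F ^+ 2 = Ex (fun x => (F x - Ex F) ^+ 2).
  rewrite [RHS](eq_Ex (G := fun x => F x ^+ 2 - 2 * Ex F * F x + Ex F ^+ 2));
    last by move=> x; ring.
  by rewrite ExD ExB ExZ Ex_const //; ring.
by apply: Ex_ge0 => x; apply: sqr_ge0.
Qed.

Lemma Ex_ffun_prod (I T : finType) (F : I -> T -> R) :
  Ex (fun f : {ffun I -> T} => \prod_i F i (f i)) = \prod_i Ex (F i).
Proof.
rewrite {1}/Ex -bigA_distr_bigA card_ffun /Ex big_split /= prodr_const natrX.
by rewrite exprVn.
Qed.

Definition ffun_upd (I T : finType) (f : {ffun I -> T}) (i : I) (a : T) :
  {ffun I -> T} := [ffun j => if j == i then a else f j].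

(** Swapping the old and the fresh value at [i] is an involution of the pairs [(f, a)]. In the
    hybrid argument this frees one block from all the others. *)
Lemma Ex_ffun_upd (I T : finType) (F : {ffun I -> T} -> R) (i : I) :
  (0 < #|T|)%N -> Ex F = Ex (fun f => Ex (fun a => F (ffun_upd f i a))).
Proof.
move=> T0.
have -> : Ex F = Ex (fun f => Ex (fun _ : T => F f)).
  by apply: eq_Ex => f; rewrite Ex_const.
rewrite -(Ex_pair (fun p => F p.1)) -(Ex_pair (fun p => F (ffun_upd p.1 i p.2))).
pose h (p : {ffun I -> T} * T) := (ffun_upd p.1 i p.2, p.1 i).
rewrite -(Ex_bij (h := h) (fun p => F p.1)) //.
by exists h => -[f a]; rewrite /h /= !ffunE eqxx; congr pair;
  apply/ffunP => j; rewrite !ffunE; case: eqP => [->|].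
Qed.

Lemma Ex_ffunS (n : nat) (T : finType) (F : {ffun 'I_n.+1 -> T} -> R) :
  Ex F = Ex (fun a => Ex (fun f : {ffun 'I_n -> T} =>
    F [ffun i => if unlift ord0 i is Some j then f j else a])).
Proof.
rewrite -(Ex_pair (fun p : T * {ffun 'I_n -> T} =>
  F [ffun i => if unlift ord0 i is Some j then p.2 j else p.1])).
rewrite -(Ex_bij (h := fun p : T * {ffun 'I_n -> T} =>
  [ffun i => if unlift ord0 i is Some j then p.2 j else p.1])) //.
exists (fun g : {ffun 'I_n.+1 -> T} => (g ord0, [ffun j => g (lift ord0 j)])).
  case=> a f; rewrite !ffunE unlift_none; congr pair.
  by apply/ffunP => j; rewrite !ffunE liftK.
move=> g; apply/ffunP => i; rewrite ffunE /=.
by case: unliftP => [j ->|->]; rewrite ?ffunE.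
Qed.

End Expectation.

(** * Fourier analysis on the cube *)

Notation cube I := {ffun I -> bool}.

Section Fourier.
Local Open Scope ring_scope.
Variables (R : realFieldType) (I : finType).
Implicit Types (A B : {set I}) (x y : cube I).

Lemma card_cube_gt0 : (0 < #|{: cube I}|)%N.
Proof. by apply/card_gt0P; exists 0. Qed.

Lemma addcc x : x + x = 0.
Proof. by apply/ffunP => i; rewrite !ffunE; exact: addbb. Qed.

Lemma addcK y : cancel (fun x => x + y) (fun x => x + y).
Proof. by move=> x; rewrite -addrA addcc addr0. Qed.

Lemma addc_eq0 x y : (x + y == 0) = (x == y).
Proof.
apply/eqP/eqP => [xy|->]; last exact: addcc.
by rewrite -[x](addcK y) xy add0r.
Qed.

Lemma Ex_shift (F : cube I -> R) y : Ex (fun x => F (x + y)) = Ex F.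
Proof. by apply: (Ex_bij F); exists (fun x => x + y); apply: addcK. Qed.

Definition chi A x : R := \prod_(i in A) (-1) ^+ x i.

Lemma chiD A x y : chi A (x + y) = chi A x * chi A y.
Proof.
by rewrite /chi -big_split; apply: eq_bigr => i _; rewrite ffunE; exact: signr_addb.
Qed.

Lemma chi_set0 x : chi set0 x = 1.
Proof. by rewrite /chi big_set0. Qed.

Lemma chi_at0 A : chi A 0 = 1.
Proof. by rewrite /chi big1 // => i _; rewrite ffunE. Qed.

Lemma norm_chi A x : `|chi A x| = 1.
Proof.
by rewrite normr_prod big1 // => i _; rewrite normrX normrN1 expr1n.
Qed.

Definition basis_vec (i : I) : cube I := [ffun j => j == i].

Lemma chi_basis A i : chi A (basis_vec i) = (-1) ^+ (i \in A).
Proof.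
rewrite /chi; case iA: (i \in A).
  rewrite (bigD1 i) //= big1 => [|j /andP[_ /negbTE ji]].
    by rewrite ffunE eqxx mulr1.
  by rewrite ffunE ji.
rewrite big1 // => j jA; rewrite ffunE.
by case: eqP => // ji; rewrite -ji jA in iA.
Qed.

(** If [A] and [B] differ at [i], shifting by the basis vector of [i] changes the sign of the
    product, so its mean equals its own negative. *)
Lemma Ex_chiM A B : Ex (fun x => chi A x * chi B x) = (A == B)%:R.
Proof.
case: eqVneq => [->|AB].
  rewrite (eq_Ex (G := fun _ => 1)) ?Ex_const ?card_cube_gt0 // => x.
  by rewrite -chiD addcc chi_at0.
have [i iAB] : exists i, (i \in A) != (i \in B).
  by apply/existsP; apply: contraNT AB => /existsPn AB; apply/eqP/setP => i;
    apply/eqP; have := AB i; rewrite negbK.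
have := Ex_shift (fun x => chi A x * chi B x) (basis_vec i).
rewrite (eq_Ex (G := fun x => -1 * (chi A x * chi B x))).
  rewrite ExZ; set e := Ex _ => ee; rewrite mulr0n; lra.
move=> x; rewrite !chiD !chi_basis mulrACA mulrC; congr (_ * _).
by case: (i \in A) iAB; case: (i \in B) => //= _; rewrite ?mulr1 ?mul1r.
Qed.

Lemma Ex_chi A : A != set0 -> Ex (chi A) = 0.
Proof.
move=> /negbTE A0; rewrite -[RHS]/(false%:R) -A0 -Ex_chiM.
by apply: eq_Ex => x; rewrite chi_set0 mulr1.
Qed.

Lemma sum_chi x : \sum_A chi A x = (x == 0)%:R * #|{: cube I}|%:R.
Proof.
have -> : \sum_A chi A x = \prod_i ((-1) ^+ x i + 1).
  rewrite bigA_distr; apply: eq_big => // A _.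
  by rewrite /chi big_mkcond.
case: eqVneq => [->|x0].
  rewrite mul1r (eq_bigr (fun _ => 2%:R)) => [|i _]; last by rewrite ffunE; ring.
  by rewrite prodr_const card_ffun card_bool natrX.
have [i xi] : exists i, x i.
  apply/existsP; apply: contraNT x0 => /existsPn x0.
  by apply/eqP/ffunP => i; rewrite ffunE; apply/negbTE.
by rewrite mul0r (bigD1 i) //= xi expr1 addNr mul0r.
Qed.

Definition fcoef (F : cube I -> R) A : R := Ex (fun x => F x * chi A x).

Lemma fourier_inv (F : cube I -> R) y : F y = \sum_A fcoef F A * chi A y.
Proof.
under eq_bigr do rewrite /fcoef -ExZr.
rewrite -Ex_sum.
rewrite (eq_Ex (G := fun x => #|{: cube I}|%:R * ((x == y)%:R * F x))); last first.
  move=> x; under eq_bigr do rewrite -mulrA -chiD.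
  by rewrite -mulr_sumr sum_chi addc_eq0; ring.
rewrite ExZ /Ex (bigD1 y) //= eqxx big1 => [|x /negbTE ->]; last by rewrite mul0r.
by rewrite mul1r addr0 mulrC divfK // pnatr_eq0 -lt0n card_cube_gt0.
Qed.

Lemma parseval (c : {set I} -> R) :
  Ex (fun x => (\sum_A c A * chi A x) ^+ 2) = \sum_A c A ^+ 2.
Proof.
rewrite (eq_Ex (G := fun x =>
  \sum_A \sum_B c A * c B * (chi A x * chi B x))); last first.
  move=> x; rewrite expr2 mulr_suml; apply: eq_bigr => A _.
  by rewrite mulr_sumr; apply: eq_bigr => B _; rewrite mulrACA.
rewrite Ex_sum; apply: eq_bigr => A _; rewrite Ex_sum (bigD1 A) //=.
rewrite ExZ Ex_chiM eqxx mulr1 big1 ?addr0 // => B BA.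
by rewrite ExZ Ex_chiM eq_sym (negbTE BA) mulr0.
Qed.

End Fourier.

(** * Averaging along a random string *)

Section Average.
Local Open Scope ring_scope.
Variables (R : realFieldType) (I O : finType) (w : O -> cube I).
Hypothesis O0 : (0 < #|O|)%N.
Implicit Types (F G : cube I -> R) (x y : cube I).

(** Convolution with the distribution of one sample of [w]. Iterating it adds independent samples,
    and characters are eigenfunctions ([iter_av_chi]). *)
Definition av F x : R := Ex (fun o => F (x + w o)).

Lemma card_ffun_gt0 Q : (0 < #|{ffun 'I_Q -> O}|)%N.
Proof. by rewrite card_ffun expn_gt0 O0. Qed.

Lemma iter_avE Q F x :
  iter Q av F x = Ex (fun s : {ffun 'I_Q -> O} => F (x + \sum_c w (s c))).
Proof.
elim: Q F x => [|Q IH] F x.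
  rewrite /= (eq_Ex (G := fun _ => F x)) ?Ex_const ?card_ffun_gt0 // => s.
  by rewrite big_ord0 addr0.
rewrite iterS {1}/av Ex_ffunS; apply: eq_Ex => a; rewrite IH.
apply: eq_Ex => s; rewrite big_ord_recl ffunE unlift_none addrA.
congr (F (_ + _)); apply: eq_bigr => c _; congr w.
by rewrite ffunE liftK.
Qed.

Lemma iter_av_ext Q F G x : F =1 G -> iter Q av F x = iter Q av G x.
Proof. by move=> FG; rewrite !iter_avE; apply: eq_Ex => s; rewrite FG. Qed.

Lemma iter_av_chi Q (A : {set I}) x :
  iter Q av (chi R A) x = Ex (fun o => chi R A (w o)) ^+ Q * chi R A x.
Proof.
elim: Q x => [|Q IH] x; first by rewrite mul1r.
rewrite iterS {1}/av (eq_Ex (G := fun o => Ex (fun o => chi R A (w o)) ^+ Q *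
  chi R A x * chi R A (w o))); last by move=> o; rewrite IH chiD mulrA.
by rewrite ExZ exprSr; ring.
Qed.

End Average.

(** * Viola's theorem *)

Section Viola.
Local Open Scope ring_scope.
Variables (R : realFieldType) (I : finType).
Implicit Types (x y : cube I) (p q : cube I -> bool).

(* Degree at most [d], expressed through iterated derivatives. *)
Fixpoint deg_le (d : nat) p : Prop :=
  if d is d'.+1 then forall y, deg_le d' (fun x => p (x + y) (+) p x)
  else forall x y, p x = p y.

Lemma deg_le_ext d p q : p =1 q -> deg_le d p -> deg_le d q.
Proof.
elim: d p q => [|d IH] p q pq /= dp; first by move=> x y; rewrite -!pq.
by move=> y; apply: IH (dp y) => x; rewrite !pq.
Qed.

Lemma deg_le_shift d p y : deg_le d p -> deg_le d (fun x => p (x + y)).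
Proof.
elim: d p => [|d IH] p /= dp; first by move=> x z; apply: dp.
move=> z; apply: deg_le_ext (IH _ (dp z)) => x.
by rewrite addrAC.
Qed.

Lemma deg_le_add d p q :
  deg_le d p -> deg_le d q -> deg_le d (fun x => p x (+) q x).
Proof.
elim: d p q => [|d IH] p q /= dp dq.
  by move=> x y; rewrite (dp x y) (dq x y).
by move=> y; apply: deg_le_ext (IH _ _ (dp y) (dq y)) => x; rewrite addbACA.
Qed.

Lemma deg_le_const d b : deg_le d (fun=> b).
Proof.
by elim: d b => [|d IH] b //= y; apply: deg_le_ext (IH false) => x; rewrite addbb.
Qed.

Lemma deg_leS d p : deg_le d p -> deg_le d.+1 p.
Proof.
elim: d p => [|d IH] p /= dp; last by move=> y; apply: IH.
by move=> y x z; rewrite (dp (x + y) (z + y)) (dp x z).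
Qed.

Lemma deg_le_trans d d' p : (d <= d')%N -> deg_le d p -> deg_le d' p.
Proof.
move=> /subnK <-; elim: (d' - d)%N => [//|k IH] dp; exact/deg_leS/IH.
Qed.

(** Leibniz rule: the derivative of x_i p in direction y is x_i (D_y p)(x) + y_i p(x + y). *)
Lemma deg_le_mulx d p i : deg_le d p -> deg_le d.+1 (fun x => x i && p x).
Proof.
elim: d p => [|d IH] p dp y.
  move=> x z /=; rewrite !ffunE (dp (x + y) x) (dp z x) (dp (z + y) x).
  by case: (x i) (y i) (z i) (p x) => [] [] [] [].
apply: deg_le_ext (deg_le_add (IH _ (dp y))
  (_ : deg_le _ (fun x => y i && p (x + y)))) => [x /=|].
  by rewrite !ffunE; case: (x i) (y i) (p x) (p (x + y)) => [] [] [] [].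
case: (y i); first exact/deg_le_shift.
exact: deg_le_const.
Qed.

Lemma deg_le_monomial (A : {set I}) :
  deg_le #|A| (fun x => [forall i in A, x i]).
Proof.
move eqn: #|A| => n; elim: n A eqn => [|n IH] A An.
  move=> x y; rewrite (cards0_eq An).
  by apply/forall_inP/forall_inP => _ i; rewrite inE.
have [i iA] : exists i, i \in A by apply/set0Pn; rewrite -card_gt0 An.
have /IH : #|A :\ i| = n by have := cardsD1 i A; rewrite iA An => -[].
move=> /(deg_le_mulx i); apply: deg_le_ext => x.
apply/andP/forall_inP => [[xi /forall_inP Ax] j jA|Ax].
  by have [->//|ji] := eqVneq j i; apply: Ax; rewrite !inE ji.
split; first exact: Ax.
by apply/forall_inP => j; rewrite !inE => /andP[_ /Ax].
Qed.

Definition sg (b : bool) : R := (-1) ^+ b.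

Lemma sgD a b : sg (a (+) b) = sg a * sg b.
Proof. exact: signr_addb. Qed.

Lemma norm_sg b : `|sg b| = 1.
Proof. by rewrite /sg normrX normrN1 expr1n. Qed.

Lemma sg_sqr b : sg b * sg b = 1.
Proof. by rewrite -sgD addbb. Qed.

Variables (O : finType) (w : O -> cube I) (beta : R).
Hypothesis O0 : (0 < #|O|)%N.
Hypothesis beta_ge0 : 0 <= beta.
Hypothesis w_bias : forall A, A != set0 -> `|Ex (fun o => chi R A (w o))| <= beta.

Lemma iter_av_lin2 Q p (T : finType) (P : T -> cube I -> bool) x (c : R) :
  (forall y, c * sg (p y) = Ex (fun t => sg (P t y))) ->
  c * iter Q (av w) (fun y => sg (p y)) x =
  Ex (fun t => iter Q (av w) (fun y => sg (P t y)) x).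
Proof.
move=> cp; rewrite iter_avE // -ExZ.
rewrite (eq_Ex (G := fun s : {ffun 'I_Q -> O} =>
   Ex (fun t => sg (P t (x + \sum_c w (s c)))))) // Ex_swap.
by apply: eq_Ex => t; rewrite iter_avE.
Qed.

(** Averaging multiplies each nontrivial Fourier coefficient by a factor of size at most
    [beta ^+ T], and the squares of the coefficients of a sign function sum to 1. *)
Lemma Ex_sqr_av T p : Ex (fun x => iter T (av w) (fun y => sg (p y)) x ^+ 2)
  <= Ex (fun x => sg (p x)) ^+ 2 + (beta ^+ T) ^+ 2.
Proof.
pose F y := sg (p y); pose l A := Ex (fun o => chi R A (w o)).
have E x : iter T (av w) F x = \sum_A (fcoef F A * l A ^+ T) * chi R A x.
  rewrite (iter_av_ext w O0 T x (fourier_inv F)) iter_avE // Ex_sum.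
  apply: eq_bigr => A _; rewrite ExZ -mulrA; congr (_ * _).
  by rewrite -iter_av_chi // iter_avE.
rewrite (eq_Ex (G := fun x => (\sum_A (fcoef F A * l A ^+ T) * chi R A x) ^+ 2));
  last by move=> x; rewrite E.
rewrite parseval (bigD1 set0) //= lerD //.
  rewrite (_ : l set0 = 1) ?expr1n ?mulr1; last first.
    by rewrite /l (eq_Ex (G := fun=> 1)) ?Ex_const // => o; rewrite chi_set0.
  rewrite /fcoef (eq_Ex (G := F)) // => x; by rewrite chi_set0 mulr1.
have FF : \sum_A fcoef F A ^+ 2 = 1.
  rewrite -parseval (eq_Ex (G := fun=> 1)) ?Ex_const ?card_cube_gt0 // => x.
  by rewrite -fourier_inv expr2 sg_sqr.
apply: (@le_trans _ _ (\sum_(A : {set I} | A != set0) fcoef F A ^+ 2 * (beta ^+ T) ^+ 2)).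
  apply: ler_sum => A A0; rewrite exprMn ler_wpM2l ?sqr_ge0 //.
  rewrite -real_normK ?num_real // ler_sqr ?nnegrE ?exprn_ge0 //.
  by rewrite normrX lerXn2r ?nnegrE ?normr_ge0 //; apply: w_bias.
rewrite -mulr_suml ler_piMl ?sqr_ge0 // -FF [leRHS](bigD1 set0) //=.
by rewrite lerDr sqr_ge0.
Qed.

(* Either the polynomial is biased, and then it is a scaled average of its
   derivatives, or Cauchy-Schwarz and Parseval bound its expectation. *)
Theorem viola d (eta : R) p Q T x :
  0 < eta -> eta <= 1 -> beta ^+ T <= eta ^+ (2 ^ d) -> (d * T <= Q)%N ->
  deg_le d p ->
  `|iter Q (av w) (fun y => sg (p y)) x - Ex (fun y => sg (p y))| <= 9 * eta ^+ 2.
Proof.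
elim: d eta p Q x => [|d IH] eta p Q x e0 e1 bT dQ dp.
  rewrite iter_avE // (eq_Ex (G := fun=> sg (p x))); last by move=> s; rewrite (dp _ x).
  rewrite [X in _ - X](eq_Ex (G := fun=> sg (p x))); last by move=> s; rewrite (dp _ x).
  rewrite !Ex_const ?card_ffun_gt0 ?card_cube_gt0 // subrr normr0.
  by rewrite mulr_ge0 // sqr_ge0.
have e0' := ltW e0; have e2 : 0 < eta ^+ 2 by rewrite exprn_gt0.
have e2' := ltW e2.
have e21 : eta ^+ 2 <= 1 by rewrite exprn_ile1 // ltW.
(* The derivatives are treated with [eta ^+ 2] in place of [eta]; squaring once per degree explains
   the exponent [2 ^ d]. *)
have bT' : beta ^+ T <= (eta ^+ 2) ^+ (2 ^ d) by rewrite -exprM -expnS.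
set mu := Ex _.
(* The threshold serves both cases. Below it, X^2 <= (9 + 1 + 9) eta^4 <= 25 eta^4 and 5 + 3 <= 9;
   above it, dividing 9 eta^4 by |mu| leaves 3 eta^2. *)
have [mu_small|mu_big] := ltP `|mu| (3 * eta ^+ 2).
  have [Q' QE dQ'] : exists2 Q', Q = (Q' + T)%N & (d * T <= Q')%N.
    exists (Q - T)%N; first by rewrite subnK // (leq_trans _ dQ) // mulSn leq_addr.
    by rewrite leq_subRL -?mulSn // (leq_trans _ dQ) // mulSn leq_addr.
  set X := iter _ _ _ _.
  suff X2 : X ^+ 2 <= (5 * eta ^+ 2) ^+ 2.
    have := X2; rewrite -real_normK ?num_real // ler_sqr ?nnegrE; last 2 first.
    - exact: normr_ge0.
    - by rewrite mulr_ge0 // ltW.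
    move=> X5; apply: le_trans (ler_normB _ _) _; lra.
  pose F y := sg (p y).
  have -> : X = iter Q' (av w) (iter T (av w) F) x by rewrite /X QE iterD.
  rewrite iter_avE //; apply: le_trans (sqr_Ex _ (card_ffun_gt0 O0 _)) _.
  (* The square of the inner average is an average over two independent sums a and b. The function
     p(y + a) + p(y + b) is the derivative in direction a + b, shifted by b, so its degree has
     dropped. *)
  pose G (t : {ffun 'I_T -> O} * {ffun 'I_T -> O}) y :=
    p (y + \sum_c w (t.1 c)) (+) p (y + \sum_c w (t.2 c)).
  have GE y : iter T (av w) F y ^+ 2 = Ex (fun t => sg (G t y)).
    rewrite iter_avE // Ex_pair expr2 -ExZ; apply: eq_Ex => s /=.
    by rewrite mulrC -ExZ; apply: eq_Ex => s'; rewrite /G sgD.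
  rewrite (eq_Ex (G := fun s : {ffun 'I_Q' -> O} =>
    Ex (fun t => sg (G t (x + \sum_c w (s c)))))); last by move=> s; rewrite GE.
  rewrite Ex_swap (eq_Ex (G := fun t => iter Q' (av w) (fun y => sg (G t y)) x));
    last by move=> t; rewrite iter_avE.
  set L := Ex _.
  pose L' := Ex (fun t => Ex (fun y => sg (G t y))).
  have LL : `|L - L'| <= 9 * (eta ^+ 2) ^+ 2.
    rewrite -ExB; apply: norm_Ex_le.
      by rewrite card_prod muln_gt0 card_ffun_gt0.
    move=> t; apply: IH => //; rewrite /G.
    move: (\sum_c _) (\sum_c _) => a b.
    apply: deg_le_ext (deg_le_shift b (dp (a + b))) => y /=.
    by rewrite addrA [y + b + a + b]addrAC -(addrA y b b) addcc addr0 addbC.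
  have L'E : L' <= mu ^+ 2 + (beta ^+ T) ^+ 2.
    rewrite /L' Ex_swap.
    rewrite (eq_Ex (G := fun x => iter T (av w) F x ^+ 2)); first exact: Ex_sqr_av.
    by move=> y; rewrite GE.
  have b2 : (beta ^+ T) ^+ 2 <= (eta ^+ 2) ^+ 2.
    rewrite ler_sqr ?nnegrE ?exprn_ge0 //; apply: le_trans bT' _.
    by rewrite ler_iXnr ?expn_gt0.
  have m2 : mu ^+ 2 <= 9 * (eta ^+ 2) ^+ 2.
    have -> : 9 * (eta ^+ 2) ^+ 2 = (3 * eta ^+ 2) ^+ 2 by ring.
    rewrite -real_normK ?num_real // ler_sqr ?nnegrE ?normr_ge0 ?mulr_ge0 //.
    exact: ltW.
  move: LL; rewrite ler_norml => /andP[_ LL].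
  rewrite exprMn.
  set e4 := (eta ^+ 2) ^+ 2 in LL b2 m2 *.
  have e40 : 0 <= e4 by apply: sqr_ge0.
  move: L L' e4 LL L'E b2 m2 e40 => L L' e4 LL L'E b2 m2 e40; lra.
set X := iter _ _ _ _.
pose G t y := p (y + t) (+) p y.
(* For fixed [y] the point [y + t] is uniform, so its sign averages to [mu]. *)
have E1 y : mu * sg (p y) = Ex (fun t => sg (G t y)).
  rewrite mulrC /mu -(Ex_shift _ y) -ExZ; apply: eq_Ex => t.
  by rewrite /G sgD mulrC addrC.
have X1 : mu * X = Ex (fun t => iter Q (av w) (fun y => sg (G t y)) x).
  exact: iter_av_lin2.
have X2 : mu * mu = Ex (fun t => Ex (fun y => sg (G t y))).
  by rewrite {2}/mu -ExZ Ex_swap; apply: eq_Ex.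
have : `|mu * X - mu * mu| <= 9 * (eta ^+ 2) ^+ 2.
  rewrite X1 X2 -ExB; apply: norm_Ex_le; first exact: card_cube_gt0.
  move=> t; apply: IH => //; last exact: dp.
  by apply: leq_trans dQ; rewrite mulSn leq_addl.
rewrite -mulrBr normrM => H.
have : 3 * eta ^+ 2 * `|X - mu| <= 9 * (eta ^+ 2) ^+ 2.
  by apply: le_trans H; rewrite ler_wpM2r.
have -> : 9 * (eta ^+ 2) ^+ 2 = (3 * eta ^+ 2) * (3 * eta ^+ 2) by ring.
rewrite ler_pM2l ?mulr_gt0 // => H3; apply: le_trans H3 _; lra.
Qed.

End Viola.

(** * Subcubes and simple functions *)

Section Subcube.
Local Open Scope ring_scope.
Variables (R : realFieldType) (I : finType).
Implicit Types (A B : {set I}) (x y a : cube I).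

Lemma sum_chi_subset B x :
  \sum_(A : {set I} | A \subset B) chi R A x =
  [forall i in B, ~~ x i]%:R * 2 ^+ #|B|.
Proof.
transitivity (\prod_i ((if i \in B then (-1) ^+ x i else 0) + 1) : R).
  rewrite bigA_distr [RHS](bigID (fun A : {set I} => A \subset B)) /=.
  rewrite [X in _ + X]big1 ?addr0 => [|A /subsetPn[i iA iB]]; last first.
    by rewrite (bigD1 i) //= iA (negbTE iB) mul0r.
  apply: eq_bigr => A /subsetP AB; rewrite /chi [LHS]big_mkcond.
  by apply: eq_bigr => i _; case: ifP => // iA; rewrite AB.
case: (boolP [forall i in B, ~~ x i]) => [/forall_inP Bx|/forall_inPn[i iB]].
  rewrite mul1r (bigID (mem B)) /= [X in _ * X]big1 ?mulr1; last first.
    by move=> i /negbTE ->; rewrite add0r.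
  rewrite -prodr_const; apply: eq_bigr => i iB.
  by rewrite iB (negbTE (Bx i iB)) -[2]/(1 + 1).
by rewrite negbK => xi; rewrite mul0r (bigD1 i) //= iB xi expr1 addNr mul0r.
Qed.

(** The subcube indicator is the mean of the [2 ^ #|B|] signed characters inside [B]. The empty set
    gives the first term, and every other character contributes at most [delta] to the mean. *)
Lemma prob_subcube (T : finType) (z : T -> cube I) (delta : R) B a :
  (0 < #|T|)%N -> 0 <= delta ->
  (forall A, A != set0 -> `|Ex (fun t => chi R A (z t))| <= delta) ->
  Ex (fun t => [forall i in B, z t i == a i]%:R) <= 2^-1 ^+ #|B| + delta.
Proof.
move=> T0 d0 zb.
have two : (0 : R) < 2 ^+ #|B| by rewrite exprn_gt0.
rewrite -(ler_pM2r two) mulrDl -exprMn mulVf ?pnatr_eq0 // expr1n -ExZr.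
rewrite (eq_Ex (G := fun t => \sum_(A : {set I} | A \subset B) chi R A (z t + a)));
  last first.
  move=> t; rewrite sum_chi_subset; congr (_%:R * _).
  congr nat_of_bool; apply: eq_forallb => i; congr (_ ==> _).
  by rewrite ffunE; case: (z t i) (a i) => [] [].
rewrite Ex_sum (bigD1 set0) ?sub0set //= lerD //.
  by rewrite (eq_Ex (G := fun=> 1)) ?Ex_const // => t; rewrite chi_set0.
apply: (@le_trans _ _ (\sum_(A : {set I} | A \subset B) delta)).
  rewrite [leRHS](bigD1 set0) ?sub0set //= -[leLHS]add0r lerD //.
  apply: ler_sum => A /andP[_ A0].
  rewrite (eq_Ex (G := fun t => chi R A (z t) * chi R A a)) => [|t]; last exact: chiD.
  rewrite ExZr; apply: le_trans (ler_norm _) _; rewrite normrM norm_chi mulr1.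
  exact: zb.
rewrite sumr_const -[X in X <= _]mulr_natr -natrX -card_powerset.
by rewrite (eq_card (B := powerset B)) // => A; rewrite powersetE.
Qed.

Definition mix (L : {set I}) (y z : cube I) : cube I :=
  [ffun i => if i \in L then y i else z i].

Lemma Ex_mix (L : {set I}) (F : cube I -> R) :
  Ex F = Ex (fun z => Ex (fun y => F (mix L y z))).
Proof.
have -> : Ex F = Ex (fun z => Ex (fun _ : cube I => F z)).
  by apply: eq_Ex => z; rewrite Ex_const // card_cube_gt0.
rewrite -(Ex_pair (fun p => F p.1)) -(Ex_pair (fun p => F (mix L p.2 p.1))).
pose h (p : cube I * cube I) := (mix L p.2 p.1, mix L p.1 p.2).
rewrite -(Ex_bij (h := h) (fun p => F p.1)) //.
by exists h => -[f a]; rewrite /h /=; congr pair;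
  apply/ffunP => j; rewrite !ffunE; case: ifP => [->|->].
Qed.

Definition parity A x : bool := \sum_(i in A) x i.

Lemma chi_parity A x : chi R A x = sg R (parity A x).
Proof.
rewrite /chi /parity; elim/big_rec2: _ => [//|i b c _ ->].
by rewrite -[RHS]/(sg R (x i (+) b)) sgD.
Qed.

Lemma parityD A x y : parity A (x + y) = parity A x (+) parity A y.
Proof.
by rewrite /parity -[RHS]big_split; apply: eq_bigr => i _; rewrite ffunE.
Qed.

Lemma deg_le_parity A : deg_le 1 (parity A).
Proof.
move=> y x z; rewrite !parityD.
by case: (parity A x) (parity A y) (parity A z) => [] [] [].
Qed.

Variables (O : finType) (w : O -> cube I) (beta : R).
Hypothesis O0 : (0 < #|O|)%N.
Hypothesis beta_ge0 : 0 <= beta.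
Hypothesis w_bias : forall A, A != set0 -> `|Ex (fun o => chi R A (w o))| <= beta.

(* The leaf indicators of [S] are averages of [2 ^ #|S|] characters. *)
Lemma viola_leaves d (eta : R) (g : cube I -> bool) Q T (S : {set I}) x :
  0 < eta -> eta <= 1 -> beta ^+ T <= eta ^+ (2 ^ d.+1) -> (d.+1 * T <= Q)%N ->
  (forall a, deg_le d.+1 (fun y => g (mix S a y))) ->
  `|iter Q (av w) (fun y => sg R (g y)) x - Ex (fun y => sg R (g y))|
    <= 2 ^+ #|S| * (9 * eta ^+ 2).
Proof.
move=> e0 e1 bT dQ dg.
(* A character is the sign of a parity, of degree 1, and adding it keeps the degree within
   [d.+1]. *)
pose H a A y := parity A y (+) g (mix S a y).
(* Only those [a] that agree with [y] on [S] contribute. They have density [2 ^ - #|S|], which the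
   value [2 ^ #|S|] of the character sum cancels, and for them [mix S a y = y]. *)
have gE y : sg R (g y) = Ex (fun a =>
    \sum_(A : {set I} | A \subset S) chi R A a * sg R (H a A y)).
  rewrite (eq_Ex (G := fun a =>
      sg R (g y) * \sum_(A : {set I} | A \subset S) chi R A (a + y))).
    rewrite ExZ (Ex_shift (fun a => \sum_(A : {set I} | A \subset S) chi R A a)).
    rewrite Ex_sum (bigD1 set0) ?sub0set //= big1 => [|A /andP[_ A0]].
      rewrite (eq_Ex (G := fun=> 1)) ?Ex_const ?card_cube_gt0 ?addr0 ?mulr1 //.
      by move=> a; rewrite chi_set0.
    exact: Ex_chi.
  move=> a; have [ya|ya] := boolP [forall i in S, ~~ (a + y) i].
    have -> : g y = g (mix S a y).
      congr g; apply/ffunP => i; rewrite ffunE; case: ifP => // iS.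
      have /forall_inP/(_ i iS) := ya; rewrite ffunE.
      by case: (a i) (y i) => [] [].
    rewrite mulr_sumr; apply: eq_bigr => A _.
    by rewrite chiD /H sgD -chi_parity; ring.
  have := sum_chi_subset S (a + y); rewrite (negbTE ya) mul0r => E.
  rewrite E mulr0.
  rewrite (eq_bigr (fun A => sg R (g (mix S a y)) * chi R A (a + y))).
    by rewrite -mulr_sumr E mulr0.
  by move=> A _; rewrite chiD /H sgD -chi_parity; ring.
have -> : iter Q (av w) (fun y => sg R (g y)) x = Ex (fun a =>
    \sum_(A : {set I} | A \subset S)
      chi R A a * iter Q (av w) (fun y => sg R (H a A y)) x).
  rewrite iter_avE // (eq_Ex (fun s => gE _)) Ex_swap; apply: eq_Ex => a.
  by rewrite Ex_sum; apply: eq_bigr => A _; rewrite ExZ iter_avE.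
have -> : Ex (fun y => sg R (g y)) = Ex (fun a =>
    \sum_(A : {set I} | A \subset S) chi R A a * Ex (fun y => sg R (H a A y))).
  rewrite (eq_Ex gE) Ex_swap; apply: eq_Ex => a.
  by rewrite Ex_sum; apply: eq_bigr => A _; rewrite ExZ.
rewrite -ExB; apply: norm_Ex_le; first exact: card_cube_gt0.
move=> a; rewrite -sumrB; apply: le_trans (ler_norm_sum _ _ _) _.
apply: (@le_trans _ _ (\sum_(A : {set I} | A \subset S) 9 * eta ^+ 2)).
  apply: ler_sum => A _; rewrite -mulrBr normrM norm_chi mul1r.
  apply: viola bT dQ _ => //; apply: deg_le_add (dg a).
  by apply: deg_le_trans (deg_le_parity A).
rewrite sumr_const -[X in X <= _]mulr_natr mulrC -natrX -card_powerset.
by rewrite (eq_card (B := powerset S)) // => A; rewrite powersetE.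
Qed.

End Subcube.

(** * Random restrictions *)

Section Restriction.
Local Open Scope ring_scope.
Variables (I J : finType) (fam : J -> {set I}) (j0 : J).
Hypothesis fam0 : fam j0 = set0.
Implicit Types (x y z : cube I) (L U : {set I}).

Definition monomial (A : {set I}) x := [forall i in A, x i].

Definition F2_poly (P : pred J) x : bool := \sum_(j | P j) monomial (fam j) x.

Definition survives L z (A : {set I}) := [forall i in A :\: L, z i].

(** Repetitions are allowed, so that the union bound runs over the [#|J| ^ q] functions; shorter
    choices are padded with [j0], whose set is empty. *)
Definition bad (q t : nat) L z :=
  [exists phi : {ffun 'I_q -> J},
    (t <= #|(\bigcup_k fam (phi k)) :&: L|)%N &&
    survives L z (\bigcup_k fam (phi k))].

Lemma bad_seq q t L z (s : seq J) :
  (size s <= q)%N -> all (survives L z \o fam) s ->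
  (t <= #|(\bigcup_(j <- s) fam j) :&: L|)%N -> bad q t L z.
Proof.
move=> sq ss ts; apply/existsP; exists [ffun k : 'I_q => nth j0 s k].
apply/andP; split.
  apply: leq_trans ts _; apply: subset_leq_card; apply: setSI.
  rewrite big_tnth; apply/bigcupsP => k _.
  have kq : (k < q)%N by apply: leq_trans sq.
  apply: subset_trans (bigcup_sup (Ordinal kq) _) => //.
  by rewrite ffunE /= (tnth_nth j0).
apply/forall_inP => i; rewrite inE => /andP[iL /bigcupP[k _]].
rewrite ffunE; case: (ltnP k (size s)) => ks.
  move=> ik; have /forall_inP -> // := allP ss _ (mem_nth j0 ks).
  by rewrite inE iL.
by rewrite nth_default // fam0 inE.
Qed.

(** Keep choosing a surviving monomial with more than [d] new variables in [L]. Either [q] choices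
    succeed, or the process stops because no such monomial is left. *)
Lemma greedy q d L z :
  (exists s : seq J, [/\ size s = q, all (survives L z \o fam) s &
     (q * d.+1 <= #|(\bigcup_(j <- s) fam j) :&: L|)%N]) \/
  (exists s : seq J, [/\ (size s <= q)%N, all (survives L z \o fam) s &
     forall j, survives L z (fam j) ->
       (#|(fam j :&: L) :\: (\bigcup_(j <- s) fam j)| <= d)%N]).
Proof.
elim: q => [|q [[s [sq ss sL]]|[s [sq ss sd]]]].
- by left; exists [::]; split.
- have [/existsP[j /andP[sj dj]]|/existsPn nj] :=
    boolP [exists j, survives L z (fam j) &&
      (d < #|(fam j :&: L) :\: (\bigcup_(j <- s) fam j)|)%N].
    left; exists (j :: s); split; rewrite /= ?sq ?sj //.
    rewrite big_cons mulSn.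
    have -> : (fam j :|: \bigcup_(j <- s) fam j) :&: L =
        (\bigcup_(j <- s) fam j :&: L) :|:
        ((fam j :&: L) :\: (\bigcup_(j <- s) fam j)).
      apply/setP => i; rewrite !inE.
      by case: (i \in fam j) (i \in L) (i \in \bigcup_(j <- s) _) => [] [] [].
    set U := \bigcup_(j <- s) fam j in sL dj *.
    have D : (U :&: L) :&: ((fam j :&: L) :\: U) = set0.
      by apply/setP => i; rewrite !inE; case: (i \in U); rewrite /= ?andbF.
    by rewrite cardsU D cards0 subn0 addnC leq_add.
  right; exists s; split; rewrite ?sq // => j sj.
  by have := nj j; rewrite sj /= -leqNgt.
- by right; exists s; split => //; apply: leqW.
Qed.

(** [S] consists of the variables covered by the greedy choice. Once these are fixed, each monomial
    either vanishes, by a zero outside [L] or in [S], or is a product of at most [d] variables. *)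
Lemma not_bad_simple (P : pred J) q d L z :
  (0 < d)%N ->
  ~~ bad q (q * d.+1) L z ->
  exists2 S : {set I}, (#|S| <= q * d.+1)%N &
    forall a, deg_le d (fun y => F2_poly P (mix L (mix S a y) z)).
Proof.
move=> d0 nbad; have [[s [sq ss sL]]|[s [sq ss sd]]] := greedy q d L z.
  by case/negP: nbad; apply: bad_seq sL => //; rewrite sq.
exists ((\bigcup_(j <- s) fam j) :&: L).
  (* If [S] were larger, the chosen list itself, padded to length [q], would witness [bad]. *)
  rewrite leqNgt; apply: contra nbad => /ltnW.
  exact: bad_seq.
move=> a; set S := _ :&: L; rewrite /F2_poly.
elim: (index_enum J) => [|j r IH].
  by apply: deg_le_ext (deg_le_const I d false) => y; rewrite big_nil.
have [Pj|/negbTE Pj] := boolP (P j); last first.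
  by apply: deg_le_ext IH => y; rewrite big_cons Pj.
apply: (@deg_le_ext _ _ (fun y => monomial (fam j) (mix L (mix S a y) z) (+)
  \sum_(j <- r | P j) monomial (fam j) (mix L (mix S a y) z))).
  by move=> y; rewrite [RHS]big_cons Pj.
apply: deg_le_add IH.
have [sj|nsj] := boolP (survives L z (fam j)); last first.
  apply: deg_le_ext (deg_le_const I d false) => y; symmetry.
  have [i] := forall_inPn nsj; rewrite inE => /andP[iL ij] zi.
  by apply/forall_inPn; exists i => //; rewrite ffunE (negbTE iL).
have [aS|naS] := boolP [forall i in fam j :&: S, a i]; last first.
  apply: deg_le_ext (deg_le_const I d false) => y; symmetry.
  have [i] := forall_inPn naS; rewrite inE => /andP[ij iS] ai.
  apply/forall_inPn; exists i => //; rewrite !ffunE iS.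
  by move: iS; rewrite inE => /andP[_ ->].
apply: deg_le_ext (deg_le_trans (sd j sj) (deg_le_monomial _)) => y.
apply/forall_inP/forall_inP => H i.
  move=> ij; rewrite !ffunE; case: ifP => iL; last first.
    by have /forall_inP -> // := sj; rewrite inE iL.
  case: ifP => iS; first by have /forall_inP -> // := aS; rewrite inE ij.
  apply: H; rewrite !inE ij iL andbT.
  by move: iS; rewrite inE iL andbT => ->.
rewrite !inE => /andP[iU /andP[ij iL]]; have := H i ij.
by rewrite !ffunE iL inE iL andbT (negbTE iU).
Qed.

Variable R : realFieldType.

Section BadProbability.
Local Open Scope ring_scope.
Variables (T Z : finType) (L : T -> {set I}) (z : T -> Z -> cube I).
Variables (t u : nat) (ph delta : R).
Hypotheses (T0 : (0 < #|T|)%N) (Z0 : (0 < #|Z|)%N).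
Hypotheses (delta_ge0 : 0 <= delta) (ph_ge0 : 0 <= ph) (tu : (t <= u)%N).
Hypothesis hash : forall A : {set I}, #|A| = t ->
  Ex (fun tau => (A \subset L tau)%:R) <= ph.
Hypothesis z_bias : forall tau (A : {set I}), A != set0 ->
  `|Ex (fun s => chi R A (z tau s))| <= delta.

Lemma subset_of_card (U : {set I}) m :
  (m <= #|U|)%N -> exists2 A : {set I}, A \subset U & #|A| = m.
Proof.
move=> mU; exists [set x in take m (enum U)].
  by apply/subsetP => i; rewrite inE => /mem_take; rewrite mem_enum.
rewrite cardsE (card_uniqP _) ?take_uniq ?enum_uniq // size_take -cardE.
by case: ltngtP mU => // ->.
Qed.

(** Cutting [U] down to at most [u] elements leaves at most [2 ^ u] candidate [t]-subsets for
    [hash]. If fewer than [t] of the kept elements lie in [L] and [U] was really cut, at least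
    [u - t] of them lie outside and must all be 1. *)
Lemma prob_bad_union (U : {set I}) :
  Ex (fun tau => Ex (fun s =>
    ((t <= #|U :&: L tau|)%N && survives (L tau) (z tau s) U)%:R))
  <= 2 ^+ u * ph + 2^-1 ^+ (u - t) + delta.
Proof.
have [U' [UU U'u U'E]] : exists U' : {set I},
    [/\ U' \subset U, (#|U'| <= u)%N & U' = U \/ #|U'| = u].
  have [Uu|/ltnW/subset_of_card[U' UU U'u]] := leqP #|U| u.
    by exists U; split => //; left.
  by exists U'; split; rewrite ?U'u //; right.
pose fits tau (A : {set I}) := (A \subset L tau)%:R : R.
apply: (@le_trans _ _ (Ex (fun tau =>
    \sum_(A : {set I} | (A \subset U') && (#|A| == t)) fits tau A +
    (2^-1 ^+ (u - t) + delta)))); last first.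
  rewrite ExD Ex_const // -[leRHS]addrA lerD2r Ex_sum.
  apply: (@le_trans _ _ (\sum_(A : {set I} | A \subset U') ph)).
    rewrite [leRHS](bigID (fun A : {set I} => #|A| == t)) /=.
    rewrite -[leLHS]addr0 lerD ?sumr_ge0 //.
    by apply: ler_sum => A /andP[_ /eqP]; apply: hash.
  rewrite sumr_const -[X in X <= _]mulr_natr mulrC.
  rewrite (eq_card (B := powerset U')) => [|A]; last by rewrite powersetE.
  by rewrite card_powerset natrX ler_wpM2r // ler_eXn2l // ltr1n.
apply: ler_Ex => tau.
have pos1 : 0 <= \sum_(A : {set I} | (A \subset U') && (#|A| == t)) fits tau A.
  by apply: sumr_ge0 => A _; apply: ler0n.
have pos2 : (0 : R) <= 2^-1 ^+ (u - t) by rewrite exprn_ge0 // invr_ge0.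
have [tL|tL] := leqP t #|U' :&: L tau|.
  have [A AU At] := subset_of_card tL; rewrite subsetI in AU.
  have /andP[AU' AL] := AU.
  apply: (@le_trans _ _ 1).
    rewrite -[leRHS](Ex_const 1 Z0); apply: ler_Ex => s.
    by case: (_ && _).
  rewrite (bigD1 A) ?AU' ?At ?eqxx //= /fits AL.
  set X := \sum_(_ | _) _.
  have X0 : 0 <= X by apply: sumr_ge0 => B _; apply: ler0n.
  by rewrite mulr1n -addrA lerDl !addr_ge0.
have [UE|U'E'] := U'E.
  rewrite -UE; rewrite (eq_Ex (G := fun=> 0)) ?Ex_const //; last first.
    by move=> s; rewrite leqNgt tL.
  by rewrite !addr_ge0.
apply: (@le_trans _ _ (Ex (fun s =>
    [forall i in U' :\: L tau, z tau s i == [ffun=> true] i]%:R))).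
  apply: ler_Ex => s; rewrite ler_nat; case: (t <= _)%N => //=.
  rewrite /survives; case: forall_inP => //= Us.
  rewrite (_ : [forall i in _, _] = true) //; apply/forall_inP => i.
  rewrite inE ffunE => /andP[iL iU]; rewrite eqb_id; apply: Us.
  by rewrite inE iL (subsetP UU).
apply: le_trans (prob_subcube _ _ Z0 delta_ge0 (z_bias tau)) _.
have : (2^-1 : R) ^+ #|U' :\: L tau| <= 2^-1 ^+ (u - t).
  apply: ler_wiXn2l.
  - by rewrite invr_ge0.
  - by rewrite invf_le1 // ler1n.
  by rewrite cardsD U'E' leq_sub2l // ltnW.
lra.
Qed.

Lemma prob_bad q :
  Ex (fun tau => Ex (fun s => (bad q t (L tau) (z tau s))%:R))
  <= #|J|%:R ^+ q * (2 ^+ u * ph + 2^-1 ^+ (u - t) + delta).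
Proof.
pose E (phi : {ffun 'I_q -> J}) tau s : R :=
  ((t <= #|(\bigcup_k fam (phi k)) :&: L tau|)%N &&
   survives (L tau) (z tau s) (\bigcup_k fam (phi k)))%:R.
apply: (@le_trans _ _ (\sum_phi Ex (fun tau => Ex (E phi tau)))).
  rewrite -Ex_sum; apply: ler_Ex => tau; rewrite -Ex_sum; apply: ler_Ex => s.
  rewrite /bad; case: existsP => [[phi Hphi]|_].
    rewrite (bigD1 phi) //= /E Hphi -[leLHS]addr0 lerD //.
    by apply: sumr_ge0 => phi' _; apply: ler0n.
  by apply: sumr_ge0 => phi' _; apply: ler0n.
apply: (@le_trans _ _ (\sum_(phi : {ffun 'I_q -> J})
    (2 ^+ u * ph + 2^-1 ^+ (u - t) + delta))).
  by apply: ler_sum => phi _; apply: prob_bad_union.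
by rewrite sumr_const -[X in X <= _]mulr_natr mulrC card_ffun card_ord natrX.
Qed.

End BadProbability.

End Restriction.

(** * Replacing the buckets one by one *)

Section Hybrid.
Local Open Scope ring_scope.
Variables (R : realFieldType) (I J : finType) (fam : J -> {set I}) (j0 : J).
Hypothesis fam0 : fam j0 = set0.
Variables (O : finType) (w : O -> cube I) (beta : R).
Hypothesis O0 : (0 < #|O|)%N.
Hypothesis beta_ge0 : 0 <= beta.
Hypothesis w_bias : forall A, A != set0 -> `|Ex (fun o => chi R A (w o))| <= beta.
Variable Q : nat.

Definition block := {ffun 'I_Q -> O}.
Definition block_out (s : block) : cube I := \sum_c w (s c).

Lemma card_block_gt0 : (0 < #|{: block}|)%N.
Proof. exact: card_ffun_gt0. Qed.

Lemma block_bias (A : {set I}) : A != set0 ->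
  `|Ex (fun s => chi R A (block_out s))| <= beta ^+ Q.
Proof.
move=> A0; have := iter_av_chi R w Q A (0 : cube I).
rewrite iter_avE // chi_at0 mulr1.
rewrite (eq_Ex (G := fun s => chi R A (block_out s))); last first.
  by move=> s; rewrite add0r.
move=> ->; rewrite normrX; apply: lerXn2r; rewrite ?nnegrE ?normr_ge0 //.
exact: w_bias.
Qed.

Variables (T K : finType) (h : T -> I -> K).
Hypothesis T0 : (0 < #|T|)%N.

Definition hyb (Z : {set K}) (tau : T) (om : {ffun K -> block}) (u : cube I) : cube I :=
  [ffun i => if h tau i \in Z then block_out (om (h tau i)) i else u i].

Definition bucket (b : K) (tau : T) : {set I} := [set i | h tau i == b].

Lemma chi_hyb (Z : {set K}) tau om u (A : {set I}) :
  chi R A (hyb Z tau om u) =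
  chi R [set i in A | h tau i \notin Z] u *
  \prod_k chi R [set i in A | (h tau i == k) && (k \in Z)] (block_out (om k)).
Proof.
rewrite {1}/chi (bigID (fun i => h tau i \notin Z)) /=; congr (_ * _).
  apply: eq_big => [i|i /andP[_ /negbTE hi]]; first by rewrite inE.
  by rewrite ffunE hi.
rewrite (partition_big (h tau) xpredT) //=; apply: eq_bigr => k _.
apply: eq_big => [i|i].
  by rewrite inE negbK -andbA; case: eqP => [->|_]; rewrite ?andbT ?andbF.
by rewrite negbK ffunE => /andP[/andP[_ ->] /eqP ->].
Qed.

(** If [A] meets an unfilled bucket, the uniform bits make the mean 0. Otherwise the buckets give
    independent factors, one of them at most [beta ^+ Q] and the others at most 1. *)
Lemma hyb_bias (Z : {set K}) tau (A : {set I}) : A != set0 ->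
  beta ^+ Q <= 1 ->
  `|Ex (fun p : {ffun K -> block} * cube I => chi R A (hyb Z tau p.1 p.2))|
    <= beta ^+ Q.
Proof.
move=> A0 b1; have bQ : 0 <= beta ^+ Q by apply: exprn_ge0.
rewrite Ex_pair.
rewrite (eq_Ex (G := fun om : {ffun K -> block} =>
  Ex (chi R [set i in A | h tau i \notin Z]) *
  \prod_k chi R [set i in A | (h tau i == k) && (k \in Z)] (block_out (om k))));
  last by move=> om /=; rewrite -ExZr; apply: eq_Ex => u; rewrite chi_hyb.
rewrite ExZ (Ex_ffun_prod (fun k s =>
  chi R [set i in A | (h tau i == k) && (k \in Z)] (block_out s))).
set A0' := [set _ in A | _].
have [A00|A00] := eqVneq A0' set0; last by rewrite Ex_chi ?mul0r ?normr0.
rewrite A00 (eq_Ex (G := fun=> 1)) => [|x]; last by rewrite chi_set0.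
rewrite Ex_const ?card_cube_gt0 // mul1r.
have [i iA] := set0Pn _ A0.
have hZ : h tau i \in Z.
  by have /setP/(_ i) := A00; rewrite !inE iA /= => /negbFE.
rewrite normr_prod (bigD1 (h tau i)) //=.
rewrite -[leRHS]mulr1 ler_pM ?normr_ge0 ?prodr_ge0 //.
  by apply: block_bias; apply/set0Pn; exists i; rewrite inE iA eqxx hZ.
apply: prodr_ile1 => k _; rewrite normr_ge0 /=.
apply: norm_Ex_le; first exact: card_block_gt0.
by move=> s; rewrite norm_chi.
Qed.

Variables (P : pred J) (q d D u : nat) (eta ph : R).
(** The target degree of this section is [d.+1], as in [viola_leaves]; [t] is the matching threshold
    of [not_bad_simple]. *)
Let t := (q * d.+2)%N.
Hypotheses (eta_gt0 : 0 < eta) (eta_le1 : eta <= 1).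
Hypothesis beta_eta : beta ^+ D <= eta ^+ (2 ^ d.+1).
Hypotheses (dQ : (d.+1 * D <= Q)%N) (bQ1 : beta ^+ Q <= 1).
Hypotheses (ph_ge0 : 0 <= ph) (tu : (t <= u)%N).
Hypothesis hash : forall b (A : {set I}), #|A| = t ->
  Ex (fun tau => (A \subset bucket b tau)%:R) <= ph.

Let F (x : cube I) : R := sg R (F2_poly fam P x).
Let EH (Z : {set K}) : R :=
  Ex (fun tau => Ex (fun om : {ffun K -> block} => Ex (fun x => F (hyb Z tau om x)))).
Let err : R :=
  2 * (#|J|%:R ^+ q * (2 ^+ u * ph + 2^-1 ^+ (u - t) + beta ^+ Q))
  + 2 ^+ t * (9 * eta ^+ 2).

Lemma hyb_filled (b : K) (Z : {set K}) tau om x : b \notin Z ->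
  hyb (b |: Z) tau om x = mix (bucket b tau) (block_out (om b)) (hyb Z tau om x).
Proof.
move=> bZ; apply/ffunP => i; rewrite !ffunE !inE.
by case: eqP => [->|//] /=.
Qed.

Lemma hyb_upd (b : K) (Z : {set K}) tau om a x : b \notin Z ->
  hyb Z tau (ffun_upd om b a) x = hyb Z tau om x.
Proof.
move=> bZ; apply/ffunP => i; rewrite !ffunE; case: ifP => // hZ.
by case: eqP => // hb; rewrite -hb hZ in bZ.
Qed.

Lemma hyb_mix (b : K) (Z : {set K}) tau om x y : b \notin Z ->
  hyb Z tau om (mix (bucket b tau) y x) = mix (bucket b tau) y (hyb Z tau om x).
Proof.
move=> bZ; apply/ffunP => i; rewrite !ffunE !inE.
by case: (eqVneq (h tau i) b) => [->|//]; rewrite (negbTE bZ).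
Qed.

(** Bucket [b] can be filled last: [Ex_ffun_upd] makes its block, and [Ex_mix] its uniform bits,
    independent of the string [z] around it. For the same [tau] and [z] the two hybrids then differ
    only in this filling. *)
Lemma hybrid_step b (Z : {set K}) : b \notin Z -> `|EH (b |: Z) - EH Z| <= err.
Proof.
move=> bZ.
pose z tau (p : {ffun K -> block} * cube I) := hyb Z tau p.1 p.2.
have E1 : EH (b |: Z) = Ex (fun tau => Ex (fun p =>
    Ex (fun s => F (mix (bucket b tau) (block_out s) (z tau p))))).
  apply: eq_Ex => tau; rewrite (Ex_ffun_upd _ b card_block_gt0) Ex_pair.
  apply: eq_Ex => om; rewrite Ex_swap; apply: eq_Ex => x; apply: eq_Ex => s.
  by rewrite hyb_filled // hyb_upd // ffunE eqxx.
have E2 : EH Z = Ex (fun tau => Ex (fun p =>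
    Ex (fun y => F (mix (bucket b tau) y (z tau p))))).
  apply: eq_Ex => tau; rewrite Ex_pair; apply: eq_Ex => om.
  rewrite (Ex_mix (bucket b tau)); apply: eq_Ex => x; apply: eq_Ex => y.
  by rewrite hyb_mix.
have Z0 : (0 < #|{: {ffun K -> block} * cube I}|)%N.
  by rewrite card_prod muln_gt0 card_cube_gt0 card_ffun expn_gt0 card_block_gt0.
have B : Ex (fun tau => Ex (fun p => (bad fam q t (bucket b tau) (z tau p))%:R))
    <= #|J|%:R ^+ q * (2 ^+ u * ph + 2^-1 ^+ (u - t) + beta ^+ Q).
  apply: prob_bad => //; first exact: exprn_ge0.
  - exact: hash.
  - by move=> tau A A0; apply: hyb_bias.
rewrite E1 E2 -ExB; apply: le_trans (norm_Ex _) _.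
have e9 : 0 <= 2 ^+ t * (9 * eta ^+ 2).
  by rewrite mulr_ge0 ?exprn_ge0 // mulr_ge0 // sqr_ge0.
apply: (@le_trans _ _ (Ex (fun tau => Ex (fun p =>
    2 * (bad fam q t (bucket b tau) (z tau p))%:R + 2 ^+ t * (9 * eta ^+ 2))))).
  apply: ler_Ex => tau; rewrite -ExB; apply: le_trans (norm_Ex _) _.
  (* A bad surrounding costs 2, the largest distance between two means of signs. A good one costs
     Viola's error times at most [2 ^ t] leaves. *)
  apply: ler_Ex => p; have [_|nb] := boolP (bad _ _ _ _ _).
    have n1 (U : finType) (G : U -> cube I) : (0 < #|U|)%N ->
        `|Ex (fun s => F (G s))| <= 1.
      by move=> U0; apply: norm_Ex_le => // s; rewrite /F norm_sg.
    have := n1 _ (fun s => mix (bucket b tau) (block_out s) (z tau p)) card_block_gt0.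
    have := n1 _ (fun y => mix (bucket b tau) y (z tau p)) (card_cube_gt0 I).
    move=> n2 n3; apply: le_trans (ler_normB _ _) _; rewrite mulr1.
    set X := `|_| in n3 *; set Y := `|_| in n2 *; lra.
  have [S St dS] := not_bad_simple fam0 P (ltn0Sn d) nb.
  have := viola_leaves O0 beta_ge0 w_bias 0 eta_gt0 eta_le1 beta_eta dQ
    (g := fun y => F2_poly fam P (mix (bucket b tau) y (z tau p))) dS.
  rewrite iter_avE //.
  rewrite (eq_Ex (G := fun s => F (mix (bucket b tau) (block_out s) (z tau p))));
    last by move=> s; rewrite add0r.
  move=> H; apply: le_trans H _; rewrite mulr0 add0r.
  apply: ler_wpM2r; first by rewrite mulr_ge0 ?sqr_ge0.
  by apply: ler_weXn2l; rewrite ?ler1n.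
rewrite (eq_Ex (G := fun tau => 2 * Ex (fun p =>
   (bad fam q t (bucket b tau) (z tau p))%:R) + 2 ^+ t * (9 * eta ^+ 2))).
  by rewrite ExD ExZ Ex_const // lerD2r ler_wpM2l.
by move=> tau; rewrite ExD ExZ Ex_const.
Qed.

Lemma hybrid :
  `|Ex (fun tau => Ex (fun om : {ffun K -> block} =>
      F [ffun i => block_out (om (h tau i)) i])) - Ex F| <= #|K|%:R * err.
Proof.
have E1 : EH setT = Ex (fun tau => Ex (fun om : {ffun K -> block} =>
      F [ffun i => block_out (om (h tau i)) i])).
  apply: eq_Ex => tau; apply: eq_Ex => om.
  rewrite -[RHS](Ex_const _ (card_cube_gt0 I)); apply: eq_Ex => x; congr F.
  by apply/ffunP => i; rewrite !ffunE inE.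
have E0 : EH set0 = Ex F.
  have om0 : (0 < #|{ffun K -> block}|)%N.
    by rewrite card_ffun expn_gt0 card_block_gt0.
  rewrite -[RHS](Ex_const _ T0); apply: eq_Ex => tau.
  rewrite -[RHS](Ex_const _ om0); apply: eq_Ex => om; apply: eq_Ex => x.
  by congr F; apply/ffunP => i; rewrite !ffunE inE.
rewrite -E1 -E0 -cardsT.
move eqn: #|[set: K]| => n; move: [set: K] eqn => Z.
elim: n Z => [|n IH] Z Zn; first by rewrite (cards0_eq Zn) subrr normr0 mul0r.
have [b bZ] : exists b, b \in Z by apply/set0Pn; rewrite -card_gt0 Zn.
have Zb : #|Z :\ b| = n by have := cardsD1 b Z; rewrite bZ Zn => -[].
have := hybrid_step (Z := Z :\ b) (b := b); rewrite !inE eqxx setD1K //.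
move=> /(_ isT) H1; have H2 := IH _ Zb.
rewrite -natr1 mulrDl mul1r [leRHS]addrC.
have -> : EH Z - EH set0 = (EH Z - EH (Z :\ b)) + (EH (Z :\ b) - EH set0) by ring.
by apply: le_trans (ler_normD _ _) (lerD _ _).
Qed.

End Hybrid.

(** * Hashing by small-bias strings *)

Section Hash.
Local Open Scope ring_scope.
Variables (R : realFieldType) (I T : finType) (V : T -> cube I) (delta : R).
Hypotheses (T0 : (0 < #|T|)%N) (delta_ge0 : 0 <= delta).
Hypothesis V_bias : forall A, A != set0 -> `|Ex (fun s => chi R A (V s))| <= delta.

Definition hash_bits kap (tau : {ffun 'I_kap -> T}) (i : I) : cube 'I_kap :=
  [ffun c => V (tau c) i].

(** All of [A] lands in [b] exactly when each of the [kap] independent strings is constant on [A]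
    with the prescribed bit, which is a subcube event. *)
Lemma prob_bucket kap (b : cube 'I_kap) (A : {set I}) :
  Ex (fun tau => (A \subset [set i | hash_bits tau i == b])%:R)
  <= (2^-1 ^+ #|A| + delta) ^+ kap.
Proof.
rewrite (eq_Ex (G := fun tau : {ffun 'I_kap -> T} =>
  \prod_c [forall i in A, V (tau c) i == [ffun=> b c] i]%:R)); last first.
  move=> tau; rewrite -natr_prod; congr (_%:R).
  case: (boolP (A \subset _)) => [/subsetP H|/subsetPn[i iA]].
    rewrite big1 // => c _; apply/eqP; rewrite eqb1; apply/forall_inP => i /H.
    by rewrite inE ffunE => /eqP <-; rewrite ffunE.
  rewrite inE => nb; have [c cb] : exists c, hash_bits tau i c != b c.
    apply/existsP; apply: contraNT nb => /existsPn E.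
    by apply/eqP/ffunP => c; apply/eqP; have := E c; rewrite negbK.
  rewrite (bigD1 c) //= (_ : [forall i in A, _] = false) //.
  apply/forall_inPn; exists i => //; rewrite ffunE.
  by move: cb; rewrite ffunE.
rewrite (Ex_ffun_prod (fun c s => [forall i in A, V s i == [ffun=> b c] i]%:R)).
have -> : (2^-1 ^+ #|A| + delta) ^+ kap = \prod_(c < kap) (2^-1 ^+ #|A| + delta).
  by rewrite prodr_const card_ord.
apply: ler_prod => c _.
rewrite Ex_ge0 => [|s]; last exact: ler0n.
exact: prob_subcube.
Qed.

End Hash.

(** * A generator with constant bias *)

Section Isolation.
Local Open Scope ring_scope.
Variables (R : realFieldType) (I : finType) (M : nat) (v : I -> cube 'I_M).
Hypothesis v_inj : injective v.
Hypothesis v_neq0 : forall i, v i != 0.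
Hypothesis card_I : (8 * #|I| <= 2 ^ M)%N.

Definition dot (g x : cube 'I_M) : bool := \sum_j (g j && x j).

Definition isolate (g : {ffun 'I_M -> cube 'I_M}) (s : nat) (i : I) : bool :=
  [forall a : 'I_M, (a < s)%N ==> dot (g a) (v i)].

(** The first [s] forms thin out the index set by about [2 ^ s]. A test set [A] is unknown, so every
    level is present, each with its own random coefficient. *)
Definition base_gen (o : cube 'I_M * {ffun 'I_M -> cube 'I_M}) : cube I :=
  [ffun i => \sum_(s < M) (o.1 s && isolate o.2 s i)].

Definition supp (x : cube 'I_M) : {set 'I_M} := [set j | x j].

Lemma supp_inj : injective supp.
Proof.
by move=> x y /setP xy; apply/ffunP => j; have := xy j; rewrite !inE.
Qed.

Lemma dotE g x : (dot g x)%:R = (1 - chi R (supp x) g) / 2.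
Proof.
have -> : chi R (supp x) g = sg R (dot g x).
  rewrite /dot /chi big_mkcond /=.
  elim/big_rec2: _ => [//|j b c _ ->].
  rewrite -[RHS]/(sg R ((g j && x j) (+) b)) sgD inE.
  by case: (x j); rewrite ?andbT ?andbF.
by case: (dot g x); rewrite /sg /= ?expr1 ?expr0; field.
Qed.

Lemma Ex_dot x : x != 0 -> Ex (fun g => (dot g x)%:R) = 2^-1 :> R.
Proof.
move=> x0; rewrite (eq_Ex (dotE ^~ x)) ExZr ExB Ex_const ?card_cube_gt0 //.
rewrite Ex_chi ?subr0 ?mul1r //.
apply: contraNneq x0 => s0; apply/eqP/supp_inj; rewrite s0.
by apply/setP => j; rewrite !inE ffunE.
Qed.

(** Pairwise independence, a consequence of the orthogonality of characters; it gives the second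
    moment in [odd_isolated]. *)
Lemma Ex_dot2 x y : x != 0 -> y != 0 -> x != y ->
  Ex (fun g => (dot g x)%:R * (dot g y)%:R) = 4^-1 :> R.
Proof.
move=> x0 y0 xy.
have supp0 z : z != 0 -> supp z != set0.
  apply: contraNneq => s0; apply/eqP/supp_inj; rewrite s0.
  by apply/setP => j; rewrite !inE ffunE.
rewrite (eq_Ex (G := fun g => 4^-1 * (1 - chi R (supp x) g - chi R (supp y) g +
   chi R (supp x) g * chi R (supp y) g))) => [|g]; last first.
  by rewrite !dotE; field.
rewrite ExZ ExD !ExB Ex_const ?card_cube_gt0 // !Ex_chi ?supp0 // Ex_chiM.
by rewrite (inj_eq supp_inj) (negbTE xy) !subr0 addr0 mulr1.
Qed.

Lemma isolateE g s i : (isolate g s i)%:R =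
  \prod_(a < M) (if (a < s)%N then (dot (g a) (v i))%:R else 1) :> R.
Proof.
rewrite /isolate; case: (boolP [forall a : 'I_M, _]) => [/forallP H|/forallPn[a]].
  rewrite big1 // => a _; case: ifP => // sa.
  by have := H a; rewrite sa => /= ->.
by rewrite negb_imply => /andP[sa /negbTE da]; rewrite (bigD1 a) //= sa da mul0r.
Qed.

Lemma prod_lt_const s (x : R) : (s <= M)%N ->
  \prod_(a < M) (if (a < s)%N then x else 1) = x ^+ s.
Proof.
move=> sM; rewrite -big_mkcond /= -(big_ord_widen M (fun=> x)) //.
by rewrite prodr_const card_ord.
Qed.

Lemma Ex_isolate s i : (s <= M)%N ->
  Ex (fun g => (isolate g s i)%:R) = 2^-1 ^+ s :> R.
Proof.
move=> sM; rewrite (eq_Ex (isolateE ^~ s ^~ i)).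
rewrite (Ex_ffun_prod (fun (a : 'I_M) ga =>
  if (a < s)%N then (dot ga (v i))%:R else 1 : R)).
rewrite -(prod_lt_const _ sM); apply: eq_bigr => a _.
by case: ifP => _; rewrite ?Ex_const ?card_cube_gt0 ?Ex_dot.
Qed.

Lemma Ex_isolate2 s i j : (s <= M)%N -> i != j ->
  Ex (fun g => (isolate g s i)%:R * (isolate g s j)%:R) = 4^-1 ^+ s :> R.
Proof.
move=> sM ij; rewrite (eq_Ex (G := fun g : {ffun 'I_M -> cube 'I_M} =>
  \prod_(a < M) (if (a < s)%N then (dot (g a) (v i))%:R * (dot (g a) (v j))%:R
                 else 1))) => [|g]; last first.
  rewrite !isolateE -big_split; apply: eq_bigr => a _.
  by rewrite /=; case: (a < s)%N; rewrite ?mul1r.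
rewrite (Ex_ffun_prod (fun (a : 'I_M) ga =>
  if (a < s)%N then (dot ga (v i))%:R * (dot ga (v j))%:R else 1 : R)).
rewrite -(prod_lt_const _ sM); apply: eq_bigr => a _.
case: ifP => _; rewrite ?Ex_const ?card_cube_gt0 // Ex_dot2 //.
by rewrite (inj_eq v_inj).
Qed.

(** The left side is 1 at [k = 1] and at most 0 elsewhere, so first and second moments bound a
    parity from below. *)
Lemma odd_ge (k : nat) : 2 * k%:R - k%:R ^+ 2 <= (odd k)%:R :> R.
Proof.
case: k => [|[|k]]; rewrite ?mulr0 ?expr0n ?subrr //=.
  by rewrite mulr1 expr1n; lra.
apply: le_trans (ler0n _ _).
rewrite -[k.+2]addn2 natrD; have := ler0n R k; nra.
Qed.

(* At the level [s] with [#|A| ~ 2 ^ s / 4] the second moment method shows that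
   exactly one element of [A] is isolated with constant probability. *)
Lemma odd_isolated (A : {set I}) : A != set0 ->
  exists s : 'I_M,
    3 / 16 <= Ex (fun g => (odd (\sum_(i in A) isolate g s i))%:R) :> R.
Proof.
move=> A0; have cA : (0 < #|A|)%N by rewrite card_gt0.
have [e1 e2] : (2 ^ trunc_log 2 #|A| <= #|A|)%N /\
    (#|A| < 2 ^ (trunc_log 2 #|A|).+1)%N.
  by have /andP := trunc_log_bounds (isT : (1 < 2)%N) cA.
set e := trunc_log 2 #|A| in e1 e2.
(* The factor 8 in [card_I] ensures that level [e.+2] exists. *)
have sM : (e.+2 < M)%N.
  rewrite -(leq_exp2l (m := 2)) //; apply: leq_trans card_I.
  have := max_card A; rewrite !expnS => H; lia.
exists (Ordinal sM) => /=; set s := e.+2.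
have sM' : (s <= M)%N by apply: ltnW.
apply: (@le_trans _ _ (Ex (fun g =>
    2 * (\sum_(i in A) (isolate g s i)%:R) - (\sum_(i in A) (isolate g s i)%:R) ^+ 2)));
  last first.
  by apply: ler_Ex => g; rewrite -natr_sum; apply: odd_ge.
rewrite ExB ExZ Ex_sum (eq_bigr (fun=> 2^-1 ^+ s)); last by move=> i _; apply: Ex_isolate.
rewrite sumr_const -[_ *+ #|A|]mulr_natr.
set m : R := #|A|%:R.
have E2 : Ex (fun g => (\sum_(i in A) (isolate g s i)%:R) ^+ 2) <=
    m * (2^-1 ^+ s + m * 4^-1 ^+ s).
  rewrite (eq_Ex (G := fun g => \sum_(i in A) \sum_(j in A)
    (isolate g s i)%:R * (isolate g s j)%:R)) => [|g]; last first.
    rewrite expr2 mulr_suml; apply: eq_bigr => i _; exact: mulr_sumr.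
  rewrite Ex_sum (_ : m * _ = \sum_(i in A) (2^-1 ^+ s + m * 4^-1 ^+ s)); last first.
    by rewrite sumr_const -[RHS]mulr_natl.
  apply: ler_sum => i iA; rewrite Ex_sum (bigD1 i) //= lerD //.
    rewrite (eq_Ex (G := fun g => (isolate g s i)%:R)) ?Ex_isolate // => g.
    by case: (isolate g s i); rewrite ?mulr1 ?mulr0.
  rewrite (eq_bigr (fun=> 4^-1 ^+ s)); last first.
    by move=> j /andP[_ ji]; apply: Ex_isolate2; rewrite // eq_sym.
  rewrite sumr_const -[_ *+ _]mulr_natl ler_wpM2r ?exprn_ge0 ?invr_ge0 //.
  rewrite /m ler_nat; apply: subset_leq_card; apply/subsetP => j.
  by rewrite unfold_in => /andP[].
apply: (@le_trans _ _ (2 * (2^-1 ^+ s * m) - m * (2^-1 ^+ s + m * 4^-1 ^+ s)));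
  last by rewrite lerD2l lerN2.
set x : R := 2^-1 ^+ s.
have -> : 4^-1 ^+ s = x * x :> R.
  by rewrite /x -exprMn -invfM -natrM.
have x1 : x * 2 ^+ s = 1 by rewrite /x -exprMn mulVf ?pnatr_eq0 // expr1n.
have x0 : 0 < x by rewrite exprn_gt0 // invr_gt0.
have m1 : 2 ^+ s <= 4 * m.
  by rewrite -natrX /m -natrM ler_nat /s !expnS; lia.
have m2 : 2 * m <= 2 ^+ s.
  by rewrite -natrX /m -natrM ler_nat /s expnS; lia.
have y1 : 1 <= 4 * (x * m) by rewrite mulrCA -[X in X <= _]x1 ler_pM2l.
have y2 : 2 * (x * m) <= 1 by rewrite mulrCA -[X in _ <= X]x1 ler_pM2l.
(* The expected number y of isolated elements lies in [1/4, 1/2], where y - y^2 is at least 3/16. *)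
have -> : 2 * (x * m) - m * (x + m * (x * x)) = x * m - (x * m) ^+ 2 by ring.
set y := x * m in y1 y2 *; nra.
Qed.

Lemma chi_base_gen (A : {set I}) c g :
  chi R A (base_gen (c, g)) =
  \prod_(s < M) sg R (c s && odd (\sum_(i in A) isolate g s i)).
Proof.
transitivity (\prod_(i in A) \prod_(s < M) sg R (c s && isolate g s i)).
  apply: eq_bigr => i _; rewrite ffunE /=.
  elim/big_rec2: _ => [//|s b x _ <-].
  by rewrite -[LHS]/(sg R ((c s && isolate g s i) (+) x)) sgD.
rewrite exchange_big; apply: eq_bigr => s _; case: (c s) => /=.
  by rewrite /sg signr_odd prodrXr.
by rewrite big1.
Qed.

(** Averaging over the coefficient of a level turns its sign into 1 minus the parity of the isolated
    elements. All these factors lie in [0, 1], and the level of [odd_isolated] gives 1 - 3/16. *)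
Lemma base_gen_bias (A : {set I}) : A != set0 ->
  `|Ex (fun o => chi R A (base_gen o))| <= 13 / 16.
Proof.
move=> /odd_isolated[s Hs].
have sgE b : Ex (fun x => sg R (x && b)) = 1 - b%:R.
  by rewrite /Ex card_bool big_bool /sg /=; case: b => /=; rewrite ?expr0 ?expr1; lra.
have E : Ex (fun o => chi R A (base_gen o)) =
    Ex (fun g => \prod_(s < M) (1 - (odd (\sum_(i in A) isolate g s i))%:R)).
  rewrite Ex_pair Ex_swap; apply: eq_Ex => g.
  rewrite (eq_Ex (G := fun c : cube 'I_M =>
    \prod_(s < M) sg R (c s && odd (\sum_(i in A) isolate g s i)))); last first.
    by move=> c; apply: chi_base_gen.
  rewrite (Ex_ffun_prod (fun (s : 'I_M) x => sg R (x && odd (\sum_(i in A) isolate g s i)))).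
  by apply: eq_bigr => s' _; apply: sgE.
have b01 (b : bool) : 0 <= 1 - b%:R :> R by case: b; rewrite ?subrr ?subr0.
rewrite E ger0_norm; last by apply: Ex_ge0 => g; apply: prodr_ge0 => s' _.
apply: (@le_trans _ _ (Ex (fun g => 1 - (odd (\sum_(i in A) isolate g s i))%:R))).
  apply: ler_Ex => g; rewrite (bigD1 s) //=; apply: ler_piMr => //.
  by apply: prodr_ile1 => s' _; rewrite b01 /= gerBl ler0n.
rewrite ExB Ex_const; last first.
  by apply/card_gt0P; exists [ffun=> 0].
set X := Ex _ in Hs *; lra.
Qed.

End Isolation.

Import Defs.

(** * The generator as a program *)

Section Logic.

(** A list of registers padded by zeros lets [/=] evaluate every register access. *)
Definition St (s : seq nat) (m : nat -> nat) : state := State (nth 0 s) m.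

(** Total correctness with a postcondition on time and final state, so that each instruction becomes
    a backward rule. *)
Definition runs (c : cmd) (st : state) (Q : nat -> state -> Prop) : Prop :=
  exists t st', exec c st t st' /\ Q t st'.

Lemma set_regE s m x v : set_reg (St s m) x v = St (set_nth 0 s x v) m.
Proof.
congr State; apply: boolp.funext => y.
by rewrite /update nth_set_nth.
Qed.

Lemma runs_Const x k s m Q : Q 1 (St (set_nth 0 s x k) m) -> runs (Const x k) (St s m) Q.
Proof.
move=> H; rewrite -set_regE in H; do 2 eexists; split; last exact: H.
exact: exec_Const.
Qed.

Lemma runs_Add x y z s m Q :
  Q 1 (St (set_nth 0 s x (nth 0 s y + nth 0 s z)) m) -> runs (Add x y z) (St s m) Q.
Proof.
move=> H; rewrite -set_regE in H; do 2 eexists; split; last exact: H.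
exact: exec_Add.
Qed.

Lemma runs_Sub x y z s m Q :
  Q 1 (St (set_nth 0 s x (nth 0 s y - nth 0 s z)) m) -> runs (Sub x y z) (St s m) Q.
Proof.
move=> H; rewrite -set_regE in H; do 2 eexists; split; last exact: H.
exact: exec_Sub.
Qed.

Lemma runs_Read x y s m Q :
  Q 1 (St (set_nth 0 s x (m (nth 0 s y))) m) -> runs (Read x y) (St s m) Q.
Proof.
move=> H; rewrite -set_regE in H; do 2 eexists; split; last exact: H.
exact: exec_Read.
Qed.

Lemma runs_Write x y s m Q :
  Q 1 (St s (update m (nth 0 s x) (nth 0 s y))) -> runs (Write x y) (St s m) Q.
Proof.
move=> H; do 2 eexists; split; last exact: H.
exact: exec_Write.
Qed.

Lemma runs_Seq c1 c2 st Q :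
  runs c1 st (fun t1 st1 => runs c2 st1 (fun t2 st2 => Q (t1 + t2) st2)) ->
  runs (Seq c1 c2) st Q.
Proof.
move=> [t1 [st1 [e1 [t2 [st2 [e2 q]]]]]]; exists (t1 + t2), st2; split => //.
exact: exec_Seq e1 e2.
Qed.

Lemma runs_If x c1 c2 s m Q :
  (nth 0 s x != 0 -> runs c1 (St s m) (fun t => Q t.+1)) ->
  (nth 0 s x = 0 -> runs c2 (St s m) (fun t => Q t.+1)) ->
  runs (If x c1 c2) (St s m) Q.
Proof.
move=> H1 H2; have [x0|x0] := eqVneq (nth 0 s x) 0.
  have [t [st' [e q]]] := H2 x0; exists t.+1, st'; split => //.
  exact: exec_IfF.
have [t [st' [e q]]] := H1 x0; exists t.+1, st'; split => //.
exact: exec_IfT.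
Qed.

Lemma runs_conseq c st (Q Q' : nat -> state -> Prop) :
  runs c st Q -> (forall t st', Q t st' -> Q' t st') -> runs c st Q'.
Proof. by move=> [t [st' [e q]]] H; exists t, st'; split => //; apply: H. Qed.

(** The index of [Inv] is the number of passes still to come, which yields termination and the time
    bound at once. *)
Lemma runs_While x c T (Inv : nat -> state -> Prop) :
  (forall st, Inv 0 st -> reg st x = 0) ->
  (forall k st, Inv k.+1 st ->
     reg st x != 0 /\ runs c st (fun t st' => t <= T /\ Inv k st')) ->
  forall N st, Inv N st ->
  runs (While x c) st (fun t st' => t <= N * T.+1 + 1 /\ Inv 0 st').
Proof.
move=> H0 HS; elim=> [|N IH] st Hst.
  by exists 1, st; split => //; apply/exec_WhileF/H0.
have [x0 [t [st1 [e1 [tT I1]]]]] := HS _ _ Hst.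
have [t2 [st2 [e2 [t2T I2]]]] := IH _ I1.
exists (t + t2).+1, st2; split; first exact: exec_WhileT e1 e2.
by split => //; lia.
Qed.

End Logic.

Ltac step := first
  [ apply: runs_Seq | apply: runs_Const | apply: runs_Add | apply: runs_Sub
  | apply: runs_Read | apply: runs_Write ]; rewrite /=.

Section Program.

Definition Skip := Const 20 0.

(* Registers: 0 n, 1 r, 2 one, 3 Q, 4 kappa, 5 M, 6 i, 7 pointer, 8 hash value,
   9 block counter, 10 output bit, 11 copy counter, 12 conjunction, 13 level
   counter, 14 coefficient, 15 rest of i + 1, 16 inner product, 17 digit
   counter, 18 seed bit, 19 quotient, 20 scratch, 21 always zero.  While the
   seed length is decoded, 9 is a flag, and 16 and 18 hold 64 and 63. *)
Definition halve : cmd :=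
  Seq (Const 19 0) (Seq (Sub 20 15 2)
  (While 20 (Seq (Sub 15 15 2) (Seq (Sub 15 15 2) (Seq (Add 19 19 2) (Sub 20 15 2)))))).

Definition inner_product : cmd :=
  While 17 (Seq (Sub 17 17 2) (Seq (Read 18 7) (Seq (Add 7 7 2) (Seq halve
  (Seq (If 15 (If 18 (Sub 16 2 16) Skip) Skip) (Add 15 19 21)))))).

Definition levels : cmd :=
  While 13 (Seq (Sub 13 13 2) (Seq (Read 14 7) (Seq (Add 7 7 2)
  (Seq (If 12 (If 14 (Sub 10 2 10) Skip) Skip)
  (Seq (Add 15 6 2) (Seq (Const 16 0) (Seq (Add 17 5 21)
  (Seq inner_product (If 16 Skip (Const 12 0)))))))))).

Definition copies : cmd :=
  Seq (Const 10 0) (Seq (Add 11 3 21)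
  (While 11 (Seq (Sub 11 11 2) (Seq (Const 12 1) (Seq (Add 13 5 21) levels))))).

Definition hashing : cmd :=
  Seq (Const 8 0) (Seq (Add 9 4 21)
  (While 9 (Seq (Sub 9 9 2) (Seq copies (Seq (Add 8 8 8) (Add 8 8 10)))))).

(** Without multiplication, the block of bucket h is reached by evaluating all bucket blocks up to
    it; [copies] resets register 10, so the last one prevails. As h is below [2 ^ kap], the time
    stays polynomial. *)
Definition selecting : cmd :=
  Seq (Add 9 8 2) (While 9 (Seq (Sub 9 9 2) copies)).

Definition output : cmd :=
  Seq (Add 6 0 21) (While 6 (Seq (Sub 6 6 2) (Seq (Add 7 0 21)
  (Seq hashing (Seq selecting (Write 6 10)))))).

(** The seed moves to the addresses from [n] on, because the output overwrites those below. *)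
Definition copy_seed : cmd :=
  Seq (Add 9 1 21) (While 9 (Seq (Sub 9 9 2) (Seq (Read 14 9)
  (Seq (Add 15 0 9) (Write 15 14))))).

Definition div64 : cmd :=
  Seq (Add 15 3 21) (Seq (Const 19 0) (Seq (Sub 20 15 18)
  (While 20 (Seq (Sub 15 15 16) (Seq (Add 19 19 2) (Sub 20 15 18)))))).

(** Dividing by 64 until a remainder appears leaves Q in register 3; each exact division increments
    kappa and doubles M = 2^kappa. *)
Definition decode : cmd :=
  Seq (Add 3 1 21) (Seq (Const 4 0) (Seq (Const 5 1) (Seq (Const 9 1)
  (Seq (Const 16 64) (Seq (Const 18 63)
  (While 9 (Seq div64 (If 15 (Const 9 0)
     (Seq (Add 3 19 21) (Seq (Add 4 4 2) (Add 5 5 5))))))))))).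

(** If [n <= r], the truncated difference is 0 and the seed in memory already is the output. *)
Definition generator : cmd :=
  Seq (Const 2 1) (Seq (Sub 20 0 1)
  (If 20 (Seq copy_seed (Seq decode output)) Skip)).

Variables (sd : nat -> bool) (M Q kap : nat).

(** From here to [out_bit], the function computed by the program. A level occupies [M.+1] seed bits,
    its coefficient followed by its form; a copy has [M] levels and a block [Q] copies. The first
    [kap] blocks hash, and block [kap + h] fills bucket h. *)
Definition digit (y j : nat) : bool := odd (iter j half y).

Definition ip (y p k : nat) : bool :=
  \big[addb/false]_(j < k) (sd (p + j) && digit y j).

Definition ip_prefix (y p s : nat) : bool :=
  \big[andb/true]_(a < s) ip y (p + a * M.+1 + 1) M.

Definition level_sum (y p s : nat) : bool :=
  \big[addb/false]_(s < s) (sd (p + s * M.+1) && ip_prefix y p s).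

Definition copy_sum (y p c : nat) : bool :=
  \big[addb/false]_(c < c) level_sum y (p + c * (M * M.+1)) M.

Definition block_len := Q * (M * M.+1).

(** The most significant bit comes first, to match the Horner scheme of [hashing]. *)
Definition binary (f : nat -> bool) (c : nat) : nat :=
  \sum_(c' < c) f c' * 2 ^ (c - c'.+1).

Definition hash_val (y p c : nat) : nat :=
  binary (fun c' => copy_sum y (p + c' * block_len) Q) c.

Definition out_bit (y : nat) : bool :=
  copy_sum y ((kap + hash_val y 0 kap) * block_len) Q.

Lemma binaryS f c : binary f c.+1 = (binary f c).*2 + f c.
Proof.
rewrite /binary big_ord_recr /= subnn expn0 muln1 -muln2 big_distrl /=.
congr (_ + _); apply: eq_bigr => i _.
have ic := ltn_ord i; rewrite -mulnA -expnSr; congr (_ * 2 ^ _); lia.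
Qed.

Lemma binary_lt f c : binary f c < 2 ^ c.
Proof.
elim: c => [|c IH]; first by rewrite /binary big_ord0.
rewrite binaryS expnS; case: (f c); lia.
Qed.

Lemma binary_inj f g c : binary f c = binary g c -> forall i, i < c -> f i = g i.
Proof.
elim: c => [|c IH] // fg i; rewrite !binaryS in fg.
have [fgc E] : f c = g c /\ binary f c = binary g c.
  by move: fg; case: (f c) (g c) => [] [] /=; lia.
rewrite ltnS leq_eqVlt => /orP[/eqP -> //|]; exact: IH.
Qed.

End Program.

(** * Correctness and running time of the loops *)

Section Verification.
Variables (n r M Q kap : nat) (m0 : nat -> nat).

Let sd (a : nat) : bool := m0 (n + a) != 0.

Local Notation RS i p h cnt acc cc bt ca c y g cj ga q x :=
  [:: n; r; 1; Q; kap; M; i; p; h; cnt; acc; cc; bt; ca; c; y; g; cj; ga; q; x].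
Lemma halve_runs i p h cnt acc cc bt ca c y g cj ga q x m :
  runs halve (St (RS i p h cnt acc cc bt ca c y g cj ga q x) m)
  (fun t st' => t <= 6 * y + 3 /\
     st' = St (RS i p h cnt acc cc bt ca c (nat_of_bool (odd y)) g cj ga y./2 0) m).
Proof.
do 2 (step; step).
pose Inv k st := k <= y./2 /\
  st = St (RS i p h cnt acc cc bt ca c (odd y + k.*2) g cj ga (y./2 - k)
             ((odd y + k.*2) - 1)) m.
apply: runs_conseq (runs_While (T := 4) (Inv := Inv) _ _ (N := y./2) _) _.
- by move=> st [_ ->] /=; case: (odd y).
- move=> k st [ky ->]; split; first by rewrite /= -lt0n; lia.
  do 3 (step; step); step; split => //; split; first by lia.
  by congr (St (RS _ _ _ _ _ _ _ _ _ _ _ _ _ _ _) _); lia.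
- by split => //; congr (St (RS _ _ _ _ _ _ _ _ _ _ _ _ _ _ _) _); lia.
- move=> t st' [tT [_ ->]]; split; first by lia.
  by congr (St (RS _ _ _ _ _ _ _ _ _ _ _ _ _ _ _) _); lia.
Qed.

Section Memory.
(* Output is written below address [n] only. *)
Variable m : nat -> nat.
Hypothesis m_seed : forall a, n <= a -> m a = m0 a.

Lemma iter_half_le j y : iter j half y <= y.
Proof. by elim: j => //= j IH; lia. Qed.

Lemma inner_product_runs i p h cnt acc cc bt ca c y ga q x :
  runs inner_product (St (RS i (n + p) h cnt acc cc bt ca c y 0 M ga q x) m)
  (fun t st' => t <= M * (6 * y + 12) + 1 /\ exists y' ga' q' x',
     st' = St (RS i (n + (p + M)) h cnt acc cc bt ca c y' (nat_of_bool (ip sd y p M)) 0 ga' q' x') m).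
Proof.
pose Inv k st := k <= M /\ exists ga q x,
  st = St (RS i (n + (p + (M - k))) h cnt acc cc bt ca c (iter (M - k) half y)
             (nat_of_bool (ip sd y p (M - k))) k ga q x) m.
apply: runs_conseq (runs_While (T := 6 * y + 11) (Inv := Inv) _ _ (N := M) _) _.
- by move=> st [_ [? [? [? ->]]]].
- move=> k st [kM [ga1 [q1 [x1 ->]]]]; split => //.
  do 3 (step; step); step.
  apply: runs_conseq (halve_runs _ _ _ _ _ _ _ _ _ _ _ _ _ _ _ _) _ => t1 _ [t1T ->].
  have yle := iter_half_le (M - k.+1) y.
  have Mk : M - k = (M - k.+1).+1 by lia.
  step.
  (* An intermediate assertion that merges the branches of the nested tests. *)
  apply: (runs_conseq (Q := fun t st' => t <= 3 /\ exists x', st' =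
    St (RS i (n + (p + (M - k))) h cnt acc cc bt ca c
         (nat_of_bool (odd (iter (M - k.+1) half y))) (nat_of_bool (ip sd y p (M - k))) k
         (m (n + (p + (M - k.+1)))) (iter (M - k.+1) half y)./2 x') m)).
    have sdE : (m (n + (p + (M - k.+1))) != 0) = sd (p + (M - k.+1)).
      by rewrite m_seed // leq_addr.
    have pE : n + (p + (M - k.+1)) + 1 = n + (p + (M - k)) by lia.
    have kE : k.+1 - 1 = k by lia.
    rewrite pE kE [in ip sd y p (M - k)]Mk /ip big_ord_recr /= -sdE -/(ip sd y p _) /digit.
    apply: runs_If => /=; case: (odd _) => //= _.
      apply: runs_If => /=.
        move=> ->; step; split => //; eexists.
        by case: (ip _ _ _ _).
      by move=> ->; step; split => //; eexists; rewrite addbF.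
    by step; split => //; eexists; rewrite andbF addbF.
  move=> t2 _ [t2T [x2 ->]]; step; split; first by lia.
  split; first by lia.
  have iE : iter (M - k) half y = (iter (M - k.+1) half y)./2 by rewrite Mk.
  by rewrite addn0 -iE; do 3 eexists.
- by split => //; do 3 eexists; rewrite subnn addn0 /ip big_ord0.
- move=> t st' [tT [_ [ga1 [q1 [x1 ->]]]]]; split; first by lia.
  by do 4 eexists; rewrite subn0.
Qed.

Lemma levels_runs i p h cnt (a0 : bool) cc c y g cj ga q x :
  runs levels (St (RS i (n + p) h cnt (nat_of_bool a0) cc 1 M c y g cj ga q x) m)
  (fun t st' => t <= M * (M * (6 * i + 18) + 15) + 1 /\
     exists bt' c' y' g' cj' ga' q' x',
     st' = St (RS i (n + (p + M * M.+1)) h cnt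
       (nat_of_bool (a0 (+) level_sum sd M i.+1 p M)) cc bt' 0 c' y' g' cj' ga' q' x') m).
Proof.
pose Inv k st := k <= M /\ exists c y g cj ga q x,
  st = St (RS i (n + (p + (M - k) * M.+1)) h cnt
     (nat_of_bool (a0 (+) level_sum sd M i.+1 p (M - k))) cc
     (nat_of_bool (ip_prefix sd M i.+1 p (M - k))) k c y g cj ga q x) m.
apply: runs_conseq (runs_While (T := M * (6 * i + 18) + 14) (Inv := Inv) _ _ (N := M) _) _.
- by move=> st [_ [? [? [? [? [? [? [? ->]]]]]]]].
- move=> k st [kM [c1 [y1 [g1 [cj1 [ga1 [q1 [x1 ->]]]]]]]]; split => //.
  have Mk : M - k = (M - k.+1).+1 by lia.
  set s := M - k.+1 in Mk *; set P := p + s * M.+1.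
  do 3 (step; step); step.
  apply: (runs_conseq (Q := fun t st' => t <= 3 /\ exists x', st' =
    St (RS i (n + (P + 1)) h cnt
      (nat_of_bool (a0 (+) level_sum sd M i.+1 p s.+1)) cc
      (nat_of_bool (ip_prefix sd M i.+1 p s)) k (m (n + P)) y1 g1 cj1 ga1 q1 x') m)).
    have sdE : (m (n + P) != 0) = sd P by rewrite m_seed // leq_addr.
    have kE : k.+1 - 1 = k by lia.
    rewrite kE -addnA [level_sum _ _ _ _ s.+1]/level_sum big_ord_recr /=.
    rewrite -/(level_sum sd M i.+1 p s) -/P -sdE.
    apply: runs_If => /=; case: (ip_prefix _ _ _ _ _) => //= _.
      apply: runs_If => /=.
        move=> ->; step; split => //; eexists; rewrite addbA.
        by case: (a0 (+) _).
      by move=> ->; step; split => //; eexists; rewrite addbF.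
    by step; split => //; eexists; rewrite andbF addbF.
  move=> t2 _ [t2T [x2 ->]]; do 3 (step; step); rewrite !addn0 (addn1 i); step.
  apply: runs_conseq (inner_product_runs _ _ _ _ _ _ _ _ _ _ _ _ _) _.
  move=> t3 _ [t3T [y3 [ga3 [q3 [x3 ->]]]]].
  have PE : P + 1 + M = p + (M - k) * M.+1 by rewrite Mk /P mulSn; lia.
  rewrite PE.
  have prefixE : ip_prefix sd M i.+1 p (M - k) = ip_prefix sd M i.+1 p s && ip sd i.+1 (P + 1) M.
    by rewrite Mk /ip_prefix big_ord_recr.
  rewrite -Mk; apply: runs_If => /=.
    case ipE : (ip _ _ _ _) => //= _; step; split; first by nia.
    split; first by lia.
    by do 7 eexists; rewrite prefixE ipE andbT.
  case ipE : (ip _ _ _ _) => //= _; step; split; first by nia.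
  split; first by lia.
  by do 7 eexists; rewrite prefixE ipE andbF.
- split => //; do 7 eexists.
  by rewrite subnn addn0 /level_sum /ip_prefix !big_ord0 addbF.
- move=> t st' [tT [_ [c1 [y1 [g1 [cj1 [ga1 [q1 [x1 ->]]]]]]]]]; split; first by nia.
  by do 8 eexists; rewrite subn0.
Qed.

Lemma copies_runs i p h cnt acc cc bt ca c y g cj ga q x :
  runs copies (St (RS i (n + p) h cnt acc cc bt ca c y g cj ga q x) m)
  (fun t st' => t <= Q * (M * (M * (6 * i + 18) + 15) + 5) + 4 /\
     exists bt' ca' c' y' g' cj' ga' q' x',
     st' = St (RS i (n + (p + block_len M Q)) h cnt
       (nat_of_bool (copy_sum sd M i.+1 p Q)) 0 bt' ca' c' y' g' cj' ga' q' x') m).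
Proof.
do 2 (step; step).
pose Inv k st := k <= Q /\ exists bt ca c y g cj ga q x,
  st = St (RS i (n + (p + (Q - k) * (M * M.+1))) h cnt
     (nat_of_bool (copy_sum sd M i.+1 p (Q - k))) k bt ca c y g cj ga q x) m.
apply: runs_conseq (runs_While (T := M * (M * (6 * i + 18) + 15) + 4)
  (Inv := Inv) _ _ (N := Q) _) _.
- by move=> st [_ [? [? [? [? [? [? [? [? [? ->]]]]]]]]]].
- move=> k st [kQ [bt1 [ca1 [c1 [y1 [g1 [cj1 [ga1 [q1 [x1 ->]]]]]]]]]]; split => //.
  have Qk : Q - k = (Q - k.+1).+1 by lia.
  do 3 (step; step); rewrite addn0 subn1 /=.
  apply: runs_conseq (levels_runs _ _ _ _ _ _ _ _ _ _ _ _ _) _.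
  move=> t3 _ [t3T [bt3 [c3 [y3 [g3 [cj3 [ga3 [q3 [x3 ->]]]]]]]]].
  split; first by lia.
  split; first by lia.
  have E : p + (Q - k.+1) * (M * M.+1) + M * M.+1 = p + (Q - k) * (M * M.+1).
    by rewrite Qk mulSn; lia.
  have copyE : copy_sum sd M i.+1 p (Q - k) = copy_sum sd M i.+1 p (Q - k.+1)
      (+) level_sum sd M i.+1 (p + (Q - k.+1) * (M * M.+1)) M.
    by rewrite Qk /copy_sum big_ord_recr.
  by rewrite E -copyE; do 9 eexists.
- split => //; do 9 eexists.
  by rewrite subnn !addn0 /copy_sum !big_ord0.
- move=> t st' [tT [_ [bt1 [ca1 [c1 [y1 [g1 [cj1 [ga1 [q1 [x1 ->]]]]]]]]]]].
  split; first by lia.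
  by do 9 eexists; rewrite subn0.
Qed.

Definition block_time (i : nat) := Q * (M * (M * (6 * i + 18) + 15) + 5) + 4.

Lemma block_time_mono i j : i <= j -> block_time i <= block_time j.
Proof.
move=> ij; rewrite /block_time leq_add2r leq_mul2l; apply/orP; right.
rewrite leq_add2r leq_mul2l; apply/orP; right.
by rewrite leq_add2r leq_mul2l; apply/orP; right; lia.
Qed.

Lemma hashing_runs i h cnt acc cc bt ca c y g cj ga q x :
  runs hashing (St (RS i n h cnt acc cc bt ca c y g cj ga q x) m)
  (fun t st' => t <= kap * (block_time i + 4) + 3 /\
     exists acc' cc' bt' ca' c' y' g' cj' ga' q' x',
     st' = St (RS i (n + kap * block_len M Q) (hash_val sd M Q i.+1 0 kap) 0
       acc' cc' bt' ca' c' y' g' cj' ga' q' x') m).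
Proof.
do 2 (step; step).
pose Inv k st := k <= kap /\ exists acc cc bt ca c y g cj ga q x,
  st = St (RS i (n + (kap - k) * block_len M Q) (hash_val sd M Q i.+1 0 (kap - k))
     k acc cc bt ca c y g cj ga q x) m.
apply: runs_conseq (runs_While (T := block_time i + 3) (Inv := Inv) _ _ (N := kap) _) _.
- by move=> st [_ [? [? [? [? [? [? [? [? [? [? [? ->]]]]]]]]]]]].
- move=> k st [kk [acc1 [cc1 [bt1 [ca1 [c1 [y1 [g1 [cj1 [ga1 [q1 [x1 ->]]]]]]]]]]]].
  split => //.
  have Qk : kap - k = (kap - k.+1).+1 by lia.
  step; step; step; rewrite subn1 /=.
  apply: runs_conseq (copies_runs _ _ _ _ _ _ _ _ _ _ _ _ _ _ _) _.
  move=> t3 _ [t3T [bt3 [ca3 [c3 [y3 [g3 [cj3 [ga3 [q3 [x3 ->]]]]]]]]]].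
  step; step; step; split; first by rewrite /block_time; lia.
  split; first by lia.
  have E : (kap - k.+1) * block_len M Q + block_len M Q = (kap - k) * block_len M Q.
    by rewrite Qk mulSn addnC.
  have hE : hash_val sd M Q i.+1 0 (kap - k) =
      hash_val sd M Q i.+1 0 (kap - k.+1) + hash_val sd M Q i.+1 0 (kap - k.+1) +
      copy_sum sd M i.+1 ((kap - k.+1) * block_len M Q) Q.
    by rewrite Qk /hash_val binaryS addnn.
  by rewrite E -hE; do 11 eexists.
- split => //; do 11 eexists.
  by rewrite subnn !addn0 /hash_val /binary !big_ord0.
- move=> t st' [tT [_ H]].
  move: H => [acc1 [cc1 [bt1 [ca1 [c1 [y1 [g1 [cj1 [ga1 [q1 [x1 ->]]]]]]]]]]].
  split; first by lia.
  by rewrite subn0; do 11 eexists.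
Qed.

Lemma selecting_runs i h cnt acc cc bt ca c y g cj ga q x :
  runs selecting (St (RS i (n + kap * block_len M Q) h cnt acc cc bt ca c y g cj ga q x) m)
  (fun t st' => t <= h.+1 * (block_time i + 2) + 2 /\
     exists p' cnt' cc' bt' ca' c' y' g' cj' ga' q' x',
     st' = St (RS i p' h cnt'
       (nat_of_bool (copy_sum sd M i.+1 ((kap + h) * block_len M Q) Q))
       cc' bt' ca' c' y' g' cj' ga' q' x') m).
Proof.
step; step.
(* Register 10 holds a block output only after the first pass, hence the guard [k < h.+1]. *)
pose Inv k st := k <= h.+1 /\ exists acc cc bt ca c y g cj ga q x,
  st = St (RS i (n + (kap + (h.+1 - k)) * block_len M Q) h
     k acc cc bt ca c y g cj ga q x) m /\
  (k < h.+1 ->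
     acc = nat_of_bool (copy_sum sd M i.+1 ((kap + (h - k)) * block_len M Q) Q)).
apply: runs_conseq (runs_While (T := block_time i + 1) (Inv := Inv) _ _ (N := h.+1) _) _.
- by move=> st [_ [? [? [? [? [? [? [? [? [? [? [? [-> _]]]]]]]]]]]]].
- move=> k st [kk [acc1 [cc1 [bt1 [ca1 [c1 [y1 [g1 [cj1 [ga1 [q1 [x1 [-> _]]]]]]]]]]]]].
  split => //.
  step; step; rewrite subn1 /=.
  apply: runs_conseq (copies_runs _ _ _ _ _ _ _ _ _ _ _ _ _ _ _) _.
  move=> t3 _ [t3T [bt3 [ca3 [c3 [y3 [g3 [cj3 [ga3 [q3 [x3 ->]]]]]]]]]].
  split; first by rewrite /block_time; lia.
  split; first by lia.
  have E : (kap + (h.+1 - k.+1)) * block_len M Q + block_len M Q =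
      (kap + (h.+1 - k)) * block_len M Q.
    by rewrite (_ : h.+1 - k = (h.+1 - k.+1).+1) ?addnS ?mulSn 1?addnC //; lia.
  by rewrite E; do 11 eexists; split => // _; rewrite subSS.
- split => //; exists acc; do 10 eexists; split; last by rewrite ltnn.
  by rewrite subnn !addn0 addn1.
- move=> t st' [tT [_ H]].
  move: H => [acc1 [cc1 [bt1 [ca1 [c1 [y1 [g1 [cj1 [ga1 [q1 [x1 [-> /(_ isT) ->]]]]]]]]]]]].
  split; first by lia.
  by rewrite !subn0; do 12 eexists.
Qed.

End Memory.

Definition output_time :=
  n * (kap * (block_time n + 4) + 2 ^ kap * (block_time n + 2) + 9) + 2.

Lemma output_runs i p h cnt acc cc bt ca c y g cj ga q x m :
  (forall a, n <= a -> m a = m0 a) ->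
  runs output (St (RS i p h cnt acc cc bt ca c y g cj ga q x) m)
  (fun t st' => t <= output_time /\
     forall a, a < n -> mem st' a = out_bit sd M Q kap a.+1).
Proof.
move=> mseed; step; step.
pose Inv k st := k <= n /\ exists m p h cnt acc cc bt ca c y g cj ga q x,
  [/\ st = St (RS k p h cnt acc cc bt ca c y g cj ga q x) m,
      forall a, n <= a -> m a = m0 a
    & forall a, k <= a < n -> m a = out_bit sd M Q kap a.+1].
apply: runs_conseq (runs_While
  (T := kap * (block_time n + 4) + 2 ^ kap * (block_time n + 2) + 8)
  (Inv := Inv) _ _ (N := n) _) _.
- move=> st [_ H].
  by move: H => [? [? [? [? [? [? [? [? [? [? [? [? [? [? [? [-> _ _]]]]]]]]]]]]]]]].
- move=> k st [kn H].
  move: H => [m1 [p1 [h1 [cnt1 [acc1 [cc1 [bt1 [ca1 [c1 [y1 [g1 [cj1 [ga1 [q1 [x1 H]]]]]]]]]]]]]]].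
  move: H => [-> m1seed m1out]; split => //.
  step; step; step; step; rewrite addn0 subn1 /=; step.
  apply: runs_conseq (hashing_runs m1seed _ _ _ _ _ _ _ _ _ _ _ _ _ _) _.
  move=> t2 st2 [t2T H].
  move: H => [acc2 [cc2 [bt2 [ca2 [c2 [y2 [g2 [cj2 [ga2 [q2 [x2 ->]]]]]]]]]]]; step.
  apply: runs_conseq (selecting_runs m1seed _ _ _ _ _ _ _ _ _ _ _ _ _ _) _.
  move=> t3 st3 [t3T H].
  move: H => [p3 [cnt3 [cc3 [bt3 [ca3 [c3 [y3 [g3 [cj3 [ga3 [q3 [x3 ->]]]]]]]]]]]]; step.
  have bt1' := block_time_mono (ltnW kn).
  have hl : hash_val sd M Q k.+1 0 kap < 2 ^ kap by apply: binary_lt.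
  have t2T' : t2 <= kap * (block_time n + 4) + 3.
    by apply: leq_trans t2T _; rewrite leq_add2r leq_mul2l leq_add2r bt1' orbT.
  have t3T' : t3 <= 2 ^ kap * (block_time n + 2) + 2.
    by apply: leq_trans t3T _; rewrite leq_add2r leq_mul // leq_add2r.
  split; first by lia.
  split; first by lia.
  do 15 eexists; split; first reflexivity.
    by move=> a na; rewrite /update; case: eqP => [ak|_]; [lia | apply: m1seed].
  move=> a /andP[ka an]; rewrite /update; case: eqP => [->//|/eqP ak].
  by apply: m1out; rewrite an andbT ltn_neqAle eq_sym ak.
- split; first by [].
  do 15 eexists; split; first by rewrite addn0.
    by [].
  by move=> a; lia.
- move=> t st' [tT [_ H]].
  move: H => [m1 [p1 [h1 [cnt1 [acc1 [cc1 [bt1 [ca1 [c1 [y1 [g1 [cj1 [ga1 [q1 [x1 H]]]]]]]]]]]]]]].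
  move: H => [-> m1seed m1out]; split; first by rewrite /output_time; lia.
  by move=> a an; apply: m1out; rewrite an.
Qed.

End Verification.

(** * Moving the seed, decoding its length, and the whole program *)

Section Setup.
Variables (n r : nat).

Local Notation RS q k m i p h cnt acc cc bt ca c y g cj ga qt x :=
  [:: n; r; 1; q; k; m; i; p; h; cnt; acc; cc; bt; ca; c; y; g; cj; ga; qt; x].

Lemma copy_seed_runs q k M i p h cnt acc cc bt ca c y g cj ga qt x m : r < n ->
  runs copy_seed (St (RS q k M i p h cnt acc cc bt ca c y g cj ga qt x) m)
  (fun t st' => t <= r * 5 + 2 /\ exists m' c' y',
     st' = St (RS q k M i p h 0 acc cc bt ca c' y' g cj ga qt x) m' /\
     forall a, m' (n + a) = if a < r then m a else m (n + a)).
Proof.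
move=> rn; step; step.
pose Inv j st := j <= r /\ exists m' c' y',
  [/\ st = St (RS q k M i p h j acc cc bt ca c' y' g cj ga qt x) m',
      forall a, a < n -> m' a = m a &
      forall a, m' (n + a) = if j <= a < r then m a else m (n + a)].
apply: runs_conseq (runs_While (T := 4) (Inv := Inv) _ _ (N := r) _) _.
- by move=> st [_ [? [? [? [-> _ _]]]]].
- move=> j st [jr [m1 [c1 [y1 [-> H1 H2]]]]]; split => //.
  do 3 (step; step); rewrite subn1 /=; step; split => //; split; first by lia.
  do 3 eexists; split; first reflexivity.
    by move=> a an; rewrite /update; case: eqP => [|_]; [lia | apply: H1].
  move=> a; rewrite /update eqn_add2l; case: eqP => [->|/eqP aj].
    by rewrite leqnn jr H1 // (ltn_trans jr).
  by rewrite H2 (leq_eqVlt j a) eq_sym (negbTE aj).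
- split => //; do 3 eexists; split; first by rewrite addn0.
    by [].
  by move=> a; case: ifP => //; lia.
- move=> t st' [tT [_ [m1 [c1 [y1 [-> _ H]]]]]]; split; first by lia.
  by do 3 eexists; split.
Qed.

Lemma div64_runs q k M i p h cnt acc cc bt ca c y cj qt x m :
  runs div64 (St (RS q k M i p h cnt acc cc bt ca c y 64 cj 63 qt x) m)
  (fun t st' => t <= q * 4 + 4 /\
     st' = St (RS q k M i p h cnt acc cc bt ca c (q %% 64) 64 cj 63 (q %/ 64) 0) m).
Proof.
step; step; step; step; step; step; rewrite addn0.
have q64 := ltn_pmod q (isT : 0 < 64).
have qE := divn_eq q 64.
pose Inv j st := j <= q %/ 64 /\
  st = St (RS q k M i p h cnt acc cc bt ca c (q %% 64 + j * 64) 64 cj 63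
             (q %/ 64 - j) ((q %% 64 + j * 64) - 63)) m.
apply: runs_conseq (runs_While (T := 3) (Inv := Inv) _ _ (N := q %/ 64) _) _.
- move=> st [_ ->] /=; lia.
- move=> j st [jq ->]; split; first by rewrite /= -lt0n; lia.
  step; step; step; step; step; split => //; split; first by lia.
  by congr (St (RS _ _ _ _ _ _ _ _ _ _ _ _ _ _ _ _ _ _) _); lia.
- split => //.
  by congr (St (RS _ _ _ _ _ _ _ _ _ _ _ _ _ _ _ _ _ _) _); lia.
- move=> t st' [tT [_ ->]]; split; first by lia.
  by congr (St (RS _ _ _ _ _ _ _ _ _ _ _ _ _ _ _ _ _ _) _); lia.
Qed.

Lemma decode_runs Q kap q k M i p h cnt acc cc bt ca c y g cj ga qt x m :
  r = 64 ^ kap * Q -> 0 < Q -> ~~ (64 %| Q) ->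
  runs decode (St (RS q k M i p h cnt acc cc bt ca c y g cj ga qt x) m)
  (fun t st' => t <= kap.+1 * (r * 4 + 9) + 7 /\ exists y' qt' x',
     st' = St (RS Q kap (2 ^ kap) i p h 0 acc cc bt ca c y' 64 cj 63 qt' x') m).
Proof.
move=> rE Q0 Q64; do 6 (step; step); rewrite addn0.
(* The pass from [Inv 1] to [Inv 0] meets the nonzero remainder and only clears the flag, hence
   [j.-1]. *)
pose Inv j st := exists y qt x, j <= kap.+1 /\
  st = St (RS (64 ^ j.-1 * Q) (kap - j.-1) (2 ^ (kap - j.-1)) i p h
     (nat_of_bool (0 < j)) acc cc bt ca c y 64 cj 63 qt x) m.
apply: runs_conseq (runs_While (T := r * 4 + 8) (Inv := Inv) _ _ (N := kap.+1) _) _.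
- by move=> st [? [? [? [_ ->]]]].
- move=> j st [y1 [qt1 [x1 [jk ->]]]]; split => //=; step.
  apply: runs_conseq (div64_runs _ _ _ _ _ _ _ _ _ _ _ _ _ _ _ _ _) _.
  have qr : 64 ^ j * Q <= r.
    by rewrite rE leq_mul2r leq_exp2l // -ltnS jk orbT.
  move=> t2 _ [t2T ->]; apply: runs_If => /=.
    case: j jk qr t2T => [|j] jk qr t2T H.
      step; split; first by lia.
      by do 3 eexists; split.
    by move: H; rewrite expnS -mulnA modnMr.
  case: j jk qr t2T => [|j] jk qr t2T H.
    by move: Q64; rewrite /dvdn expn0 mul1n in H *; rewrite H.
  step; step; step; step; step; split; first by lia.
  do 3 eexists; split; first by lia.
  have kj : kap - j = (kap - j.+1).+1 by lia.
  rewrite expnS -mulnA mulKn // addn0 kj addn1 addnn -mul2n -expnS.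
  reflexivity.
- do 3 eexists; split => //=; rewrite subnn expn0 -rE.
  reflexivity.
- move=> t st' [tT [y1 [qt1 [x1 [_ ->]]]]]; split; first by lia.
  by do 3 eexists; rewrite /= subn0 expn0 mul1n.
Qed.

Theorem generator_short (s : bitstring r) : r < n -> forall Q kap,
  r = 64 ^ kap * Q -> 0 < Q -> ~~ (64 %| Q) ->
  exists t st, [/\ exec generator (initial_state n s) t st,
    t <= r * 5 + kap.+1 * (r * 4 + 9) + 12 + output_time n (2 ^ kap) Q kap &
    forall a, a < n -> mem st a = out_bit (fun b => nth false s b) (2 ^ kap) Q kap a.+1].
Proof.
move=> rn Q kap rE Q0 Q64.
pose m a := nat_of_bool (nth false s a).
have -> : initial_state n s =
    St [:: n; r; 0; 0; 0; 0; 0; 0; 0; 0; 0; 0; 0; 0; 0; 0; 0; 0; 0; 0; 0] m.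
  congr State; apply: boolp.funext => a.
  by do 21 (case: a => [//|a]); rewrite nth_default.
suff [t [st [e [tT H]]]] : runs generator
    (St [:: n; r; 0; 0; 0; 0; 0; 0; 0; 0; 0; 0; 0; 0; 0; 0; 0; 0; 0; 0; 0] m)
    (fun t st => t <= r * 5 + kap.+1 * (r * 4 + 9) + 12 + output_time n (2 ^ kap) Q kap /\
     forall a, a < n -> mem st a = out_bit (fun b => nth false s b) (2 ^ kap) Q kap a.+1).
  by exists t, st.
step; step; step; step; apply: runs_If => /= H; last by lia.
step; apply: runs_conseq (copy_seed_runs _ _ _ _ _ _ _ _ _ _ _ _ _ _ _ _ _ _ _ rn) _.
move=> t1 _ [t1T [m1 [c1 [y1 [-> m1E]]]]]; step.
apply: runs_conseq (decode_runs _ _ _ _ _ _ _ _ _ _ _ _ _ _ _ _ _ _ _ rE Q0 Q64) _.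
move=> t2 _ [t2T [y2 [qt2 [x2 ->]]]].
apply: runs_conseq (output_runs _ _ _ _ _ _ _ _ _ _ _ _ _ _ _ _ _ _ _
  (fun a _ => erefl (m1 a))) _.
move=> t3 st3 [t3T H3]; split; first by lia.
move=> a an; rewrite H3 //; congr (nat_of_bool (out_bit _ _ _ _ _)).
(* Beyond the seed both sides are 0: the memory there is untouched, and [nth] returns its
   default. *)
apply: boolp.funext => b; rewrite m1E /m.
case: ifP => br; first by case: (nth _ _ _).
rewrite !nth_default ?size_tuple //; first by rewrite leqNgt br.
by apply: leq_trans (leq_addr _ _); apply: ltnW.
Qed.

Theorem generator_long (s : bitstring r) : n <= r ->
  exists t st, [/\ exec generator (initial_state n s) t st, t <= 4 &
    forall a, a < n -> mem st a = nth false s a].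
Proof.
move=> nr; pose m a := nat_of_bool (nth false s a).
have -> : initial_state n s =
    St [:: n; r; 0; 0; 0; 0; 0; 0; 0; 0; 0; 0; 0; 0; 0; 0; 0; 0; 0; 0; 0] m.
  congr State; apply: boolp.funext => a.
  by do 21 (case: a => [//|a]); rewrite nth_default.
suff [t [st [e [tT H]]]] : runs generator
    (St [:: n; r; 0; 0; 0; 0; 0; 0; 0; 0; 0; 0; 0; 0; 0; 0; 0; 0; 0; 0; 0] m)
    (fun t st => t <= 4 /\ forall a, a < n -> mem st a = nth false s a).
  by exists t, st.
step; step; step; step; apply: runs_If => /= H; first by lia.
by step.
Qed.

End Setup.

(** * From seeds to blocks *)

Section Digits.

Lemma iter_half0 j : iter j half 0 = 0.
Proof. by elim: j => //= j ->. Qed.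

Lemma digit_inj M y y' : y < 2 ^ M -> y' < 2 ^ M ->
  (forall j, j < M -> digit y j = digit y' j) -> y = y'.
Proof.
elim: M y y' => [|M IH] y y'; first by rewrite expn0 !ltnS !leqn0 => /eqP -> /eqP ->.
rewrite expnS => yM y'M H.
have E : y./2 = y'./2.
  apply: IH; [lia | lia |] => j jM.
  by have := H j.+1 jM; rewrite /digit !iterSr.
by have := H 0 isT; rewrite /digit /= => o; rewrite -(odd_double_half y) o E odd_double_half.
Qed.

Variables (n M : nat).
Hypothesis nM : (8 * n <= 2 ^ M)%N.

(** The digits of [i.+1] rather than [i] keep every vector nonzero, as the isolation argument
    requires. *)
Definition index_vec (i : 'I_n) : cube 'I_M := [ffun j : 'I_M => digit i.+1 j].

Lemma index_lt (i : 'I_n) : i.+1 < 2 ^ M.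
Proof. by have := ltn_ord i; lia. Qed.

Lemma index_vec_inj : injective index_vec.
Proof.
move=> i i' /ffunP E; apply/val_inj/succn_inj.
apply: (digit_inj (index_lt i) (index_lt i')) => j jM.
by have := E (Ordinal jM); rewrite !ffunE.
Qed.

Lemma index_vec_neq0 (i : 'I_n) : index_vec i != 0%R.
Proof.
apply/eqP => /ffunP E.
suff : i.+1 = 0 by [].
apply: (@digit_inj M); rewrite ?expn_gt0 ?index_lt // => j jM.
by have := E (Ordinal jM); rewrite !ffunE /digit iter_half0.
Qed.

End Digits.

Section Seeds.
Variables (n kap Q r : nat).
Let M := 2 ^ kap.
Hypothesis fits : (kap + M) * (Q * (M * M.+1)) <= r.

Definition base_seed : finType := (cube 'I_M * {ffun 'I_M -> cube 'I_M})%type.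
Definition blocks : finType :=
  ({ffun 'I_kap -> {ffun 'I_Q -> base_seed}} *
   {ffun cube 'I_kap -> {ffun 'I_Q -> base_seed}})%type.
(** Block, copy, level and place within the level, where [None] stands for the coefficient. *)
Definition bit_index : finType :=
  (('I_kap + cube 'I_kap) * 'I_Q * 'I_M * option 'I_M)%type.

Definition bucket_number (b : cube 'I_kap) : nat :=
  binary (fun c => if insub c is Some c' then b c' else false) kap.

Lemma bucket_number_lt b : bucket_number b < M.
Proof. exact: binary_lt. Qed.

Lemma bucket_number_inj : injective bucket_number.
Proof.
move=> b b' /binary_inj E; apply/ffunP => c.
by have := E c (ltn_ord c); rewrite valK.
Qed.

Definition block_number (b : 'I_kap + cube 'I_kap) : nat :=
  match b with inl c => c | inr k => kap + bucket_number k end.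

Lemma block_number_lt b : block_number b < kap + M.
Proof.
case: b => [c|k] /=; first by rewrite (leq_trans (ltn_ord c)) ?leq_addr.
by rewrite ltn_add2l bucket_number_lt.
Qed.

Lemma block_number_inj : injective block_number.
Proof.
move=> [c|k] [c'|k'] //=.
- by move=> /val_inj ->.
- by have := ltn_ord c; lia.
- by have := ltn_ord c'; lia.
- by move=> /addnI/bucket_number_inj ->.
Qed.

Definition level_number (o : option 'I_M) : nat :=
  if o is Some j then j.+1 else 0.

Definition address (x : bit_index) : nat :=
  let: (b, c, a, o) := x in
  block_number b * (Q * (M * M.+1)) + c * (M * M.+1) + a * M.+1 + level_number o.

Lemma radix_inj B a a' b b' : b < B -> b' < B -> a * B + b = a' * B + b' ->
  a = a' /\ b = b'.
Proof.
move=> bB b'B E; have B0 : 0 < B by apply: leq_ltn_trans bB.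
have := congr1 (divn^~ B) E; rewrite !divnMDl // !divn_small // !addn0 => aa.
by split=> //; move: E; rewrite aa => /addnI.
Qed.

Lemma level_number_lt o : level_number o < M.+1.
Proof. by case: o => //= j; rewrite ltnS. Qed.

Lemma addressE b c a o : address (b, c, a, o) =
  ((block_number b * Q + c) * M + a) * M.+1 + level_number o.
Proof. by rewrite /address !mulnDl !mulnA. Qed.

Lemma address_lt x : address x < r.
Proof.
case: x => [[[b c] a] o]; apply: leq_trans fits; rewrite addressE.
have H1 := block_number_lt b; have H2 := ltn_ord c; have H3 := ltn_ord a.
have H4 := level_number_lt o.
have radix x X y Y : x < X -> y < Y -> x * Y + y < X * Y.
  by move=> xX yY; apply: (@leq_trans (x.+1 * Y)); [rewrite mulSn; lia | rewrite leq_mul2r xX orbT].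
have := radix _ _ _ _ (radix _ _ _ _ (radix _ _ _ _ H1 H2) H3) H4.
by rewrite -!mulnA.
Qed.

Lemma address_inj : injective address.
Proof.
move=> [[[b c] a] o] [[[b' c'] a'] o']; rewrite !addressE => E.
have [E1 E2] := radix_inj (level_number_lt o) (level_number_lt o') E.
have [E3 /val_inj ->] := radix_inj (ltn_ord a) (ltn_ord a') E1.
have [/block_number_inj -> /val_inj ->] := radix_inj (ltn_ord c) (ltn_ord c') E3.
by congr (_, _); case: o o' E2 {E} => [j|] [j'|] //= [] /val_inj ->.
Qed.

Definition block_of (x : blocks) (b : 'I_kap + cube 'I_kap) : {ffun 'I_Q -> base_seed} :=
  match b with inl c => x.1 c | inr k => x.2 k end.

Definition decode_block (sd : nat -> bool) (b : 'I_kap + cube 'I_kap) :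
    {ffun 'I_Q -> base_seed} :=
  [ffun c => ([ffun a => sd (address (b, c, a, None))],
              [ffun a => [ffun j => sd (address (b, c, a, Some j))]])].

Definition decode_seed (sd : nat -> bool) : blocks :=
  ([ffun c => decode_block sd (inl c)], [ffun k => decode_block sd (inr k)]).

Definition bit_at (x : blocks) (j : bit_index) : bool :=
  let: (b, c, a, o) := j in
  let s := block_of x b c in if o is Some j then s.2 a j else s.1 a.

Definition encode (x : blocks) : cube 'I_r :=
  [ffun p : 'I_r => if [pick j | address j == p :> nat] is Some j then bit_at x j else false].

Definition cube_fun (s : cube 'I_r) (a : nat) : bool :=
  if insub a is Some p then s p else false.

Lemma encodeE x j : cube_fun (encode x) (address j) = bit_at x j.
Proof.
rewrite /cube_fun insubT ?address_lt // => lt_r; rewrite ffunE /=.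
case: pickP => [j' /eqP /address_inj -> //|/(_ j)].
by rewrite eqxx.
Qed.

Lemma cube_funD (s s' : cube 'I_r) a : cube_fun (s + s')%R a = (cube_fun s a + cube_fun s' a)%R.
Proof. by rewrite /cube_fun; case: insubP => // p _ _; rewrite ffunE. Qed.

Lemma decode_seedD (s : cube 'I_r) x :
  decode_seed (cube_fun (s + encode x)%R) = (decode_seed (cube_fun s) + x)%R.
Proof.
case: x => x1 x2; congr pair; apply/ffunP => b; rewrite !ffunE; apply/ffunP => c;
  rewrite !ffunE; [move: (encodeE (x1, x2)) | move: (encodeE (x1, x2))] => E.
- have := fun a o => E (inl b, c, a, o); rewrite /bit_at /=.
  case: (x1 b c) => y1 y2 /= E'; congr pair; apply/ffunP => a; rewrite !ffunE.
    by rewrite cube_funD; congr (_ + _)%R; exact: (E' a None).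
  by apply/ffunP => j; rewrite !ffunE cube_funD; congr (_ + _)%R; exact: (E' a (Some j)).
have := fun a o => E (inr b, c, a, o); rewrite /bit_at /=.
case: (x2 b c) => y1 y2 /= E'; congr pair; apply/ffunP => a; rewrite !ffunE.
  by rewrite cube_funD; congr (_ + _)%R; exact: (E' a None).
by apply/ffunP => j; rewrite !ffunE cube_funD; congr (_ + _)%R; exact: (E' a (Some j)).
Qed.

Lemma Ex_decode (R : realFieldType) (F : blocks -> R) :
  Ex (fun s : cube 'I_r => F (decode_seed (cube_fun s))) = Ex F.
Proof.
have B0 : 0 < #|{: blocks}| by apply/card_gt0P; exists (0, 0)%R.
rewrite -[LHS](Ex_const _ B0).
rewrite (eq_Ex (G := fun x : blocks => Ex (fun s : cube 'I_r =>
  F (decode_seed (cube_fun s) + x)%R))); last first.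
  by move=> x; rewrite -(Ex_shift _ (encode x)); apply: eq_Ex => s; rewrite decode_seedD.
rewrite Ex_swap -[RHS](Ex_const _ (card_cube_gt0 'I_r)); apply: eq_Ex => s.
apply: Ex_bij; exists (fun x => x - decode_seed (cube_fun s))%R => x.
  by rewrite [(_ + x)%R]addrC addrK.
by rewrite addrC subrK.
Qed.

Lemma ip_dot sd y p (g : cube 'I_M) (i : 'I_n) : y = i.+1 ->
  (forall j : 'I_M, sd (p + j) = g j) ->
  ip sd y p M = dot g (index_vec M i).
Proof.
move=> -> H; rewrite /ip /dot.
apply: (@eq_bigr _ _ addb) => j _; rewrite H; congr (_ && _).
by rewrite ffunE.
Qed.

Lemma copy_sum_block sd (b : 'I_kap + cube 'I_kap) (i : 'I_n) :
  copy_sum sd M i.+1 (block_number b * block_len M Q) Q =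
  block_out (base_gen (index_vec M)) (decode_block sd b) i.
Proof.
rewrite /block_out sum_ffunE /copy_sum.
apply: (@eq_bigr _ _ addb) => c _; rewrite !ffunE /level_sum /=.
apply: (@eq_bigr _ _ addb) => s _; rewrite ffunE /= addn0; congr (_ && _).
rewrite /ip_prefix /isolate.
have ipE (a : 'I_M) : ip sd i.+1 (block_number b * block_len M Q + c * (M * M.+1) +
     a * M.+1 + 1) M =
   dot ([ffun a => [ffun j => sd (address (b, c, a, Some j))]] a) (index_vec M i).
  by apply: ip_dot => // j; rewrite !ffunE /= /block_len -addnA.
apply/idP/forallP => [H a|H].
  apply/implyP => sa; rewrite -ipE.
  by move: H; rewrite big_all_cond => /allP/(_ (Ordinal sa)); rewrite mem_index_enum => /(_ isT).
rewrite big_all_cond; apply/allP => a _ /=.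
have aM : a < M by apply: ltn_trans (ltn_ord a) _.
by have /implyP/(_ (ltn_ord a)) := H (Ordinal aM); rewrite -ipE.
Qed.

Lemma out_bit_block sd (i : 'I_n) (x := decode_seed sd)
    (w := base_gen (index_vec (n := n) M)) :
  out_bit sd M Q kap i.+1 = block_out w (x.2 (hash_bits (block_out w (Q := Q)) x.1 i)) i.
Proof.
rewrite /out_bit; have -> : hash_val sd M Q i.+1 0 kap =
    bucket_number (hash_bits (block_out w (Q := Q)) x.1 i).
  rewrite /hash_val /bucket_number /binary; apply: eq_bigr => c _.
  congr (_ * _); rewrite valK ffunE /x ffunE add0n.
  by rewrite -[val c]/(block_number (inl c)) copy_sum_block.
by rewrite -[_ + _]/(block_number (inr _)) copy_sum_block /x [in RHS]ffunE.
Qed.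

End Seeds.

(** * Sparse polynomials as parities of monomials *)

Section Sparse.

Lemma F2_bool (b b' : bool) : (b%:R = b'%:R :> 'F_2)%R -> b = b'.
Proof. by case: b b' => [] []. Qed.

Lemma F2_addb (b b' : bool) : ((b (+) b')%:R = b%:R + b'%:R :> 'F_2)%R.
Proof. by case: b b' => [] [] //; apply/val_inj. Qed.

Lemma F2_neq0 (x : 'F_2) : (x != 0)%R -> (x = 1)%R.
Proof. by case: x => [[|[|x]] Hx] //= _; apply/val_inj. Qed.

(** Over F_2 nonzero coefficients are 1 and only the vanishing of an exponent matters. [P] discards
    the indices beyond the support; [None] provides the empty set that pads tuples. *)
Lemma sparse_F2_polyE n S (f : bitstring n -> bool) : sparse_F2_poly S f ->
  exists (fam : option 'I_S -> {set 'I_n}) (P : pred (option 'I_S)),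
    fam None = set0 /\
    forall x : bitstring n, f x = F2_poly fam P [ffun i => tnth x i].
Proof.
move=> [p [pS fp]].
pose m (k : nat) := nth mpoly.mnm0 (mpoly.msupp p) k.
exists (fun o : option 'I_S =>
  if o is Some k then [set i | mpoly.fun_of_multinom (m k) i != 0] else set0).
exists (fun o : option 'I_S => if o is Some k then k < size (mpoly.msupp p) else false).
split=> // x; apply: F2_bool; rewrite fp mpoly.mevalE /F2_poly.
rewrite (big_morph (fun b : bool => b%:R : 'F_2)%R F2_addb (erefl _)).
rewrite (big_nth mpoly.mnm0) big_mkord.
rewrite (big_ord_widen S (fun k => mpoly.mcoeff (m k) p *
  \prod_(i < n) (tnth x i)%:R ^+ mpoly.fun_of_multinom (m k) i)%R pS).
rewrite [RHS](bigID (pred1 None)) /= [X in (X + _)%R]big_pred0 ?add0r; last first.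
  by move=> [k|] /=; rewrite ?andbF.
rewrite [RHS](reindex_omap Some id) /=; last by case.
rewrite big_mkcond [RHS]big_mkcond; apply: eq_bigr => k _.
rewrite !eqxx !andbT; case: ifP => // km.
rewrite (F2_neq0 (_ : mpoly.mcoeff (m k) p != 0)%R) ?mul1r; last first.
  by rewrite -mpoly.mcoeff_msupp mem_nth.
rewrite /monomial; case: (boolP [forall i in _, _]) => [/forall_inP H|/forall_inPn[i]].
  rewrite big1 // => i _.
  have [->|e] := eqVneq (mpoly.fun_of_multinom (m k) i) 0; first by rewrite expr0.
  by have := H i; rewrite inE ffunE => /(_ e) ->; rewrite expr1n.
rewrite inE ffunE => mki /negbTE xi; rewrite (bigD1 i) //= xi.
by rewrite expr0n (negbTE mki) mul0r.
Qed.

End Sparse.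

(** * The error of the generator in terms of its parameters *)

Section Fooling.
Local Open Scope ring_scope.
Variables (R : realFieldType) (n S k q Q r : nat).
Let t := (q * k.+1)%N.
Let kap := (10 * k)%N.
Let M := (2 ^ kap)%N.
Hypotheses (k0 : (0 < k)%N) (q0 : (0 < q)%N).
Hypothesis Qbig : (k * (4 * k * t * 2 ^ k) <= Q)%N.
Hypothesis nM : (8 * n <= 2 ^ M)%N.
Hypothesis Sk : (S.+1 <= 2 ^ (k * k))%N.
Hypothesis fits : ((kap + M) * (Q * (M * M.+1)) <= r)%N.

Let b : R := 13 / 16.
Let x : R := 2^-1.

Lemma half_ge0 : 0 <= x. Proof. by rewrite invr_ge0. Qed.
Lemma half_le1 : x <= 1. Proof. by rewrite invf_le1 // ler1n. Qed.

Lemma half_anti i j : (i <= j)%N -> x ^+ j <= x ^+ i.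
Proof. by move=> ij; apply: ler_wiXn2l => //; [exact: half_ge0 | exact: half_le1]. Qed.

Lemma mul_half i j : 2 ^+ i * x ^+ (i + j) = x ^+ j.
Proof. by rewrite exprD mulrA -exprMn mulfV ?pnatr_eq0 // expr1n mul1r. Qed.

Lemma b_ge0 : 0 <= b. Proof. rewrite /b; lra. Qed.

(** Four samples halve the bias, since (13/16)^4 < 1/2. *)
Lemma b_pow m j : (4 * m <= j)%N -> b ^+ j <= x ^+ m.
Proof.
move=> mj; apply: (@le_trans _ _ (b ^+ (4 * m))).
  by apply: ler_wiXn2l => //; rewrite /b; lra.
rewrite exprM; apply: lerXn2r; rewrite ?nnegrE ?exprn_ge0 ?b_ge0 ?half_ge0 //.
rewrite /b /x; lra.
Qed.

Lemma kt_ge_t : (t <= k * t)%N. Proof. by rewrite leq_pmull. Qed.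

Lemma t_ge2 : (2 <= t)%N. Proof. exact: (leq_mul q0 (_ : 1 < k.+1)%N). Qed.

Lemma Q_ge : (4 * (2 * (k * t)) <= Q)%N.
Proof.
apply: leq_trans Qbig; have e2 : (2 <= 2 ^ k)%N by rewrite (leq_exp2l 1).
move: (2 ^ k)%N e2 => e e2.
have -> : (k * (4 * k * t * e) = (k * e) * (4 * (k * t)))%N by lia.
by rewrite mulnCA leq_mul // (leq_mul k0 e2).
Qed.

Lemma bQ : b ^+ Q <= x ^+ (2 * (k * t)).
Proof. exact/b_pow/Q_ge. Qed.

Definition gen_bits (s : cube 'I_r) : cube 'I_n :=
  [ffun i : 'I_n => out_bit (cube_fun s) M Q kap i.+1].

Theorem fool_sparse (fam : option 'I_S -> {set 'I_n}) (P : pred (option 'I_S)) :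
  fam None = set0 ->
  `|Ex (fun s => sg R (F2_poly fam P (gen_bits s))) - Ex (fun y => sg R (F2_poly fam P y))|
    <= 2 ^+ (10 * k + 4) * x ^+ (k * t).
Proof.
move=> fam0; pose w := base_gen (index_vec (n := n) M).
have wb : forall A : {set 'I_n}, A != set0 -> `|Ex (fun o => chi R A (w o))| <= b.
  move=> A; apply: base_gen_bias.
  - exact: index_vec_inj.
  - exact: index_vec_neq0.
  - by rewrite card_ord.
have O0 : (0 < #|{: base_seed kap}|)%N by apply/card_gt0P; exists 0.
have T0 : (0 < #|{ffun 'I_kap -> {ffun 'I_Q -> base_seed kap}}|)%N.
  by apply/card_gt0P; exists 0.
pose h (tau : {ffun 'I_kap -> {ffun 'I_Q -> base_seed kap}}) (i : 'I_n) :=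
  hash_bits (block_out w (Q := Q)) tau i.
pose ph : R := (x ^+ t + b ^+ Q) ^+ kap.
have bQ0 : 0 <= b ^+ Q by rewrite exprn_ge0 ?b_ge0.
have kE : k = k.-1.+1 by rewrite prednK.
have tE : t = (q * k.-1.+2)%N by rewrite -kE.
(* Then [x ^+ (u - t)] is 2^-(2kt), small enough against the at most 2^(kt) tuples of monomials. *)
pose u := (t + 2 * (k * t))%N.
have eta0 : 0 < x ^+ (k * t) by rewrite exprn_gt0 // invr_gt0.
(* With eta = 2^-(kt), the error 9 eta^2 survives the [2 ^ t] leaves. Each of the [k] degrees takes
   [4 * k * t * 2 ^ k] samples, which bring the bias down to eta^(2^k). *)
have H := @hybrid R 'I_n (option 'I_S) fam None fam0 (base_seed kap) w b O0
  b_ge0 wb Q {ffun 'I_kap -> {ffun 'I_Q -> base_seed kap}} (cube 'I_kap) h T0 P q k.-1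
  (4 * k * t * 2 ^ k)%N u (x ^+ (k * t)) ph eta0.
rewrite -tE -kE in H.
have {H} : `|Ex (fun tau => Ex (fun om : {ffun cube 'I_kap -> {ffun 'I_Q -> base_seed kap}} =>
      sg R (F2_poly fam P [ffun i => block_out w (om (h tau i)) i])))
     - Ex (fun y => sg R (F2_poly fam P y))| <=
   #|{: cube 'I_kap}|%:R *
   (2 * (#|{: option 'I_S}|%:R ^+ q * (2 ^+ u * ph + x ^+ (u - t) + b ^+ Q)) +
    2 ^+ t * (9 * (x ^+ (k * t)) ^+ 2)).
  apply: H => //.
  - by rewrite exprn_ile1 ?half_ge0 ?half_le1.
  - by rewrite -exprM; apply: b_pow; lia.
  - by rewrite exprn_ile1 ?b_ge0 // /b; lra.
  - by rewrite exprn_ge0 // addr_ge0 // exprn_ge0 ?half_ge0.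
  - move=> c A At; rewrite /ph -At; apply: prob_bucket => //.
      by apply/card_gt0P; exists 0.
    by move=> B; apply: block_bias; rewrite ?b_ge0.
have -> : Ex (fun s => sg R (F2_poly fam P (gen_bits s))) =
    Ex (fun tau => Ex (fun om : {ffun cube 'I_kap -> {ffun 'I_Q -> base_seed kap}} =>
      sg R (F2_poly fam P [ffun i => block_out w (om (h tau i)) i]))).
  rewrite -(Ex_pair (fun p : blocks kap Q =>
    sg R (F2_poly fam P [ffun i => block_out w (p.2 (h p.1 i)) i]))) -(Ex_decode fits).
  apply: eq_Ex => s; congr (sg R (F2_poly fam P _)); apply/ffunP => i.
  by rewrite [LHS]ffunE [RHS]ffunE; apply: out_bit_block.
move=> H; apply: le_trans H _.
rewrite card_ffun card_bool !card_ord card_option card_ord natrX.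
have t2 := t_ge2; have ktt := kt_ge_t.
have Sq : S.+1%:R ^+ q <= (2 ^+ (k * t) : R).
  rewrite -!natrX ler_nat; apply: (@leq_trans ((2 ^ (k * k)) ^ q)%N).
    by rewrite leq_exp2r.
  by rewrite -expnM leq_exp2l // /t; nia.
have ph_le : 2 ^+ u * ph <= x ^+ (2 * (k * t)).
  have bt : b ^+ Q <= x ^+ t.
    by apply: le_trans bQ (half_anti _); lia.
  (* Origin of the 10 in [kap]: as t >= 2, the exponent 10 k (t - 1) is at least 5 k t, and the
     target is t + 4 k t. *)
  have : ph <= x ^+ (u + 2 * (k * t)).
    apply: (@le_trans _ _ ((x ^+ (t - 1)) ^+ kap)).
      apply: lerXn2r.
      - by rewrite nnegrE addr_ge0 // exprn_ge0 // half_ge0.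
      - by rewrite nnegrE exprn_ge0 // half_ge0.
      have -> : x ^+ (t - 1) = x ^+ t + x ^+ t.
        have {2 3}-> : t = (t - 1).+1 by lia.
        by rewrite exprS /x; lra.
      by rewrite lerD2l.
    by rewrite -exprM; apply: half_anti; rewrite /u /kap; nia.
  by move=> phl; rewrite -(mul_half u) ler_wpM2l // exprn_ge0.
have ut : x ^+ (u - t) = x ^+ (2 * (k * t)) by rewrite /u addKn.
have E1 : S.+1%:R ^+ q * (2 ^+ u * ph + x ^+ (u - t) + b ^+ Q) <= 3 * x ^+ (k * t).
  apply: (@le_trans _ _ (2 ^+ (k * t) * (3 * x ^+ (2 * (k * t))))).
    apply: ler_pM => //; first by rewrite exprn_ge0.
      rewrite addr_ge0 ?addr_ge0 ?exprn_ge0 ?half_ge0 ?b_ge0 // mulr_ge0 ?exprn_ge0 //.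
      by rewrite addr_ge0 // exprn_ge0 // half_ge0.
    rewrite ut; have := bQ; move: ph_le; set B := b ^+ Q; set Y := x ^+ _.
    by set Z := 2 ^+ u * ph; lra.
  by rewrite mulrCA mul2n -addnn mul_half.
have E2 : 2 ^+ t * (9 * (x ^+ (k * t)) ^+ 2) <= 9 * x ^+ (k * t).
  rewrite mulrCA ler_wpM2l // -exprM.
  have -> : (k * t * 2 = t + (k * t + (k * t - t)))%N by lia.
  by rewrite mul_half; apply: half_anti; lia.
rewrite exprD -mulrA ler_wpM2l ?exprn_ge0 //.
(* Per bucket the error is at most 2 * 3 + 9 = 15 times 2^-(kt). *)
have -> : (2 : R) ^+ 4 = 16 by rewrite -natrX.
have := ltW eta0; move: E1 E2; set X := x ^+ (k * t); lra.
Qed.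

End Fooling.

(** * Choice of constants *)

From mathcomp Require Import all_classical all_reals all_analysis.

Import Order.TTheory GRing.Theory Num.Theory.

Local Open Scope classical_set_scope.
Local Open Scope ring_scope.

Section Log2.
Variable R : realType.
Implicit Types x y : R.

Lemma ln2_gt0 : 0 < ln 2 :> R.
Proof. by rewrite ln_gt0 // ltr1n. Qed.

Lemma powR2E y : 2 `^ y = expR (y * ln 2) :> R.
Proof. by rewrite /powR pnatr_eq0. Qed.

Lemma log2_ge x y : 0 < x -> (y <= log2 x) = (2 `^ y <= x).
Proof.
by move=> x0; rewrite /log2 powR2E ler_pdivlMr ?ln2_gt0 // -[LHS]ler_expR lnK ?posrE.
Qed.

Lemma log2_lt x y : 0 < x -> (log2 x < y) = (x < 2 `^ y).
Proof. by move=> x0; rewrite ltNge log2_ge // -ltNge. Qed.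

Lemma powR2_nat (m : nat) : 2 `^ m%:R = (2 ^ m)%N%:R :> R.
Proof. by rewrite powR_mulrn // natrX. Qed.

Lemma log2_lt_nat (a m : nat) : (0 < a)%N -> (log2 (a%:R : R) < m%:R) = (a < 2 ^ m)%N.
Proof. by move=> a0; rewrite log2_lt ?ltr0n // powR2_nat ltr_nat. Qed.

Lemma log2_nat_ge0 (a : nat) : 0 <= log2 (a%:R : R).
Proof.
case: a => [|a]; first by rewrite /log2 ln0 // mul0r.
by rewrite log2_ge ?ltr0n // powRr0 ler1n.
Qed.

End Log2.

Section Instantiation.
Variable R : realType.
Variables (S : nat -> nat) (eps : nat -> R).

Definition deg_par (n : nat) : nat := (Num.truncn (Num.sqrt (log2 ((S n)%:R : R)))).+1.
Definition err_par (n : nat) : nat := (Num.truncn (log_inv (eps n))).+1.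
Definition hash_par (n : nat) : nat := 10 * deg_par n.
(** Doubling and adding 1 makes the number odd, hence prime to 64. *)
Definition copies_par (n : nat) : nat :=
  (4 * deg_par n * deg_par n * (err_par n * (deg_par n).+1) * 2 ^ deg_par n).*2.+1.
(* The 64-adic valuation of the seed length tells the program the value of
   [hash_par n]. *)
Definition long_seed (n : nat) : nat := 64 ^ hash_par n * copies_par n.
Definition seed_par (n : nat) : nat := if (long_seed n < n)%N then long_seed n else n.

Definition prg (n : nat) (s : bitstring (seed_par n)) : bitstring n :=
  [tuple if (seed_par n < n)%N
         then out_bit (fun a => nth false s a) (2 ^ hash_par n) (copies_par n)
                (hash_par n) i.+1
         else nth false s i | i < n].

Lemma copies_par_odd n : ~~ (64 %| copies_par n)%N.
Proof.
rewrite /copies_par; set c := (_ * _)%N; apply/negP => /dvdnP[m E].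
by have := congr1 odd E; rewrite oddM andbF /= odd_double.
Qed.

Lemma long_seed_eq n : (seed_par n < n)%N -> seed_par n = long_seed n.
Proof. by rewrite /seed_par; case: ifP => //; rewrite ltnn. Qed.

(** The six factors: output bits, blocks, copies, levels, digits, and the cost of halving by
    repeated subtraction. *)
Lemma run_time_le (X n r Q kap M : nat) :
  (0 < X -> n <= X -> r <= X -> Q <= X -> kap <= X -> 2 ^ kap <= X -> M <= X ->
  r * 5 + kap.+1 * (r * 4 + 9) + 12 + output_time n M Q kap <= 200 * X ^ 6)%N.
Proof.
move=> X0 nX rX QX kX pX MX; rewrite /output_time /block_time.
have B1 : (6 * n + 18 <= 24 * X)%N by lia.
have B2 : (M * (6 * n + 18) + 15 <= 39 * (X * X))%N.
  have := leq_mul MX B1; nia.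
have B3 : (M * (M * (6 * n + 18) + 15) + 5 <= 44 * (X * (X * X)))%N.
  have := leq_mul MX B2; move: (M * _)%N => A H.
  have : (1 * (1 * 1) <= X * (X * X))%N by rewrite !leq_mul.
  nia.
have B4 : (Q * (M * (M * (6 * n + 18) + 15) + 5) + 4 <= 48 * (X * (X * (X * X))))%N.
  have := leq_mul QX B3; move: (Q * _)%N => A H.
  have : (1 * (1 * (1 * 1)) <= X * (X * (X * X)))%N by rewrite !leq_mul.
  nia.
move: (Q * _ + 4)%N B4 => BT B4.
have P4 : (1 * (1 * (1 * 1)) <= X * (X * (X * X)))%N by rewrite !leq_mul.
set Y := (X * (X * (X * X)))%N in B4 P4.
have C1 : (kap * (BT + 4) <= X * (52 * Y))%N by apply: leq_mul; lia.
have C2 : (2 ^ kap * (BT + 2) <= X * (52 * Y))%N by apply: leq_mul; lia.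
have P5 : (1 * 1 <= X * Y)%N by apply: leq_mul; lia.
have C3 : (kap * (BT + 4) + 2 ^ kap * (BT + 2) + 9 <= 113 * (X * Y))%N by lia.
have C4 := leq_mul nX C3.
have C5 : (kap.+1 * (r * 4 + 9) <= (2 * X) * (13 * X))%N by apply: leq_mul; lia.
have E6 : (X ^ 6 = X * (X * Y))%N by rewrite /Y !expnS expn0 muln1.
have P6 : (1 * 1 <= X * (X * Y))%N by apply: leq_mul; lia.
have XX : (X * X * 1 <= X * (X * Y))%N by rewrite -mulnA !leq_mul //; lia.
have X1 : (X * (1 * 1) <= X * (X * Y))%N by rewrite !leq_mul //; lia.
by rewrite E6; lia.
Qed.

Lemma prg_efficient : efficient_generator prg.
Proof.
exists generator, 200 => n s.
have X0 : (0 < n + 2 ^ seed_par n)%N by rewrite addn_gt0 expn_gt0 orbT.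
have [rn|nr] := ltnP (seed_par n) n.
  have E := long_seed_eq rn.
  have [t [st [e tT H]]] := generator_short s rn E (ltn0Sn _) (copies_par_odd n).
  exists t, st; split => //; last first.
    by move=> i; rewrite H // tnth_mktuple rn.
  apply: leq_trans tT _.
  have h64 : (0 < 64 ^ hash_par n)%N by rewrite expn_gt0.
  have rX : (seed_par n <= n + 2 ^ seed_par n)%N.
    by apply: leq_trans (ltnW (ltn_expl _ _)) (leq_addl _ _).
  have c0 : (0 < copies_par n)%N by [].
  have MX : (2 ^ hash_par n <= n + 2 ^ seed_par n)%N.
    apply: leq_trans rX; rewrite E -[X in (X <= _)%N]muln1; apply: leq_mul => //.
    by rewrite leq_exp2r // /hash_par.
  apply: leq_trans (run_time_le X0 (leq_addr _ _) rX _ _ MX MX) _.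
  - by apply: leq_trans rX; rewrite E leq_pmull.
  - by apply: leq_trans MX; rewrite ltnW // ltn_expl.
  - by rewrite leq_mul2l leq_pexp2l.
have [t [st [e tT H]]] := generator_long s nr.
exists t, st; split => //.
  by apply: leq_trans tT _; rewrite (@leq_trans (200 * 1)) // leq_mul2l expn_gt0 X0.
by move=> i; rewrite H // tnth_mktuple ltnNge nr.
Qed.

Definition to_cube m (s : bitstring m) : cube 'I_m := [ffun i => tnth s i].

Lemma to_cube_bij m : bijective (@to_cube m).
Proof.
exists (fun x : cube 'I_m => [tuple x i | i < m]) => [s|x].
  by apply: eq_from_tnth => i; rewrite tnth_mktuple ffunE.
by apply/ffunP => i; rewrite ffunE tnth_mktuple.
Qed.

Lemma cube_fun_to_cube m (s : bitstring m) a : cube_fun (to_cube s) a = nth false s a.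
Proof.
rewrite /cube_fun; case: insubP => [i _ <-|]; first by rewrite ffunE (tnth_nth false).
by rewrite -leqNgt => ma; rewrite nth_default ?size_tuple.
Qed.

Lemma Ex_bool (T : finType) (f : T -> bool) : (0 < #|T|)%N ->
  uniform_expectation R f = (1 - Ex (fun x => sg R (f x))) / 2.
Proof.
move=> T0; rewrite -[uniform_expectation R f]/(Ex (fun x => (f x)%:R)).
rewrite -[X in X - _](Ex_const 1 T0) -ExB -ExZr; apply: eq_Ex => x.
by case: (f x); rewrite /sg /= ?expr1 ?expr0; lra.
Qed.

Lemma dist_half_le (x y : R) : `|(1 - x) / 2 - (1 - y) / 2| <= `|x - y|.
Proof.
have -> : (1 - x) / 2 - (1 - y) / 2 = - (x - y) / 2 by lra.
rewrite normrM normrN (ger0_norm (_ : 0 <= 2^-1)) ?invr_ge0 //.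
by rewrite ler_piMr // invf_le1 // ler1n.
Qed.

Lemma card_bitstring_gt0 m : (0 < #|{: bitstring m}|)%N.
Proof. by rewrite card_tuple card_bool expn_gt0. Qed.

(** A free [m] allows the substitution that the type [bitstring (seed_par n)] would block. *)
Lemma trunc_expectation m n (f : bitstring n -> bool) : m = n ->
  uniform_expectation R (fun s : bitstring m => f [tuple nth false s i | i < n])
  = uniform_expectation R f.
Proof.
move=> ->; apply: (@eq_Ex R) => s; congr ((f _)%:R).
by apply: eq_from_tnth => i; rewrite tnth_mktuple (tnth_nth false).
Qed.

(** All that is used of large [n]; the second part is the growth hypothesis on [S] with constant
    1. *)
Definition large n := 10 <= log2 (log2 (n%:R : R)) /\
  `|log2 (log2 (n%:R : R)) ^+ 2| <= `|log2 ((S n)%:R : R)|.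

Lemma eps_gt n : 0 < eps n -> 2^-1 ^+ err_par n <= eps n.
Proof.
move=> e0; have : log2 (eps n)^-1 < (err_par n)%:R.
  apply: le_lt_trans (truncnS_gt _); by rewrite /log_inv le_max lexx orbT.
rewrite log2_lt ?invr_gt0 // powR2_nat natrX => /ltW.
by rewrite exprVn -lef_pV2 ?posrE ?invrK ?exprn_gt0 // invr_gt0.
Qed.

Section Large.
Variable n : nat.
Hypothesis n_large : large n.
Let L : R := Num.sqrt (log2 ((S n)%:R : R)).
Let k := deg_par n.
Let q := err_par n.

Lemma loglog_le : log2 (log2 (n%:R : R)) <= L.
Proof.
have [l10] := n_large.
rewrite [X in _ <= X]ger0_norm ?log2_nat_ge0 // ger0_norm ?sqr_ge0 //.
move=> H; rewrite -(ler_pXn2r (n := 2)) ?nnegrE ?sqrtr_ge0 //; last lra.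
by rewrite sqr_sqrtr // log2_nat_ge0.
Qed.

Lemma L_ge10 : 10 <= L.
Proof. by apply: le_trans loglog_le; have [] := n_large. Qed.

Lemma L_lt_k : L < k%:R.
Proof. exact: truncnS_gt. Qed.

Lemma k_ge11 : (11 <= k)%N.
Proof.
by rewrite -(ltr_nat R); apply: le_lt_trans L_lt_k; apply: L_ge10.
Qed.

Lemma k_le : k%:R <= 2 * L.
Proof.
have L10 := L_ge10; rewrite /k /deg_par -/L -natr1.
have : (Num.truncn L)%:R <= L by rewrite truncn_le; lra.
lra.
Qed.

Lemma S_le : ((S n).+1 <= 2 ^ (k * k))%N.
Proof.
have L10 := L_ge10.
have S0 : (0 < S n)%N.
  rewrite lt0n; apply/eqP => S0; move: L10; rewrite /L S0 /log2 ln0 // mul0r sqrtr0.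
  lra.
rewrite -(log2_lt_nat R _ S0) -(sqr_sqrtr (log2_nat_ge0 R (S n))) -/L natrM -expr2.
by rewrite ltr_pXn2r ?nnegrE ?ler0n ?L_lt_k //; lra.
Qed.

(** The growth of [S] gives log log n <= sqrt(log S) < k, that is n < 2^(2^k). *)
Lemma n_le : (8 * n <= 2 ^ (2 ^ hash_par n))%N.
Proof.
have [l10 _] := n_large.
have l0 : 0 < log2 (n%:R : R).
  rewrite lt_neqAle log2_nat_ge0 andbT; apply/eqP => E.
  move: l10; rewrite -E /log2 ln0 // mul0r; lra.
have n0 : (0 < n)%N.
  by rewrite lt0n; apply/eqP => n0; move: l0; rewrite n0 /log2 ln0 // mul0r ltxx.
have nk : (n < 2 ^ (2 ^ k))%N.
  rewrite -(log2_lt_nat R _ n0) -powR2_nat -log2_lt //.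
  by apply: le_lt_trans loglog_le L_lt_k.
apply: (@leq_trans (2 ^ (3 + 2 ^ k))%N).
  by rewrite expnD leq_mul // ltnW.
have k11 := k_ge11; rewrite leq_exp2l // /hash_par -/k.
apply: (@leq_trans (2 ^ (k + 2))%N); last by rewrite leq_exp2l //; lia.
by rewrite expnD; have := ltn_expl k (isT : (1 < 2)%N); lia.
Qed.

(** With M = [2 ^ hash_par n], the power of 64 is M^6, while each copy index accounts for at most 4
    M^3 seed bits over all blocks. *)
Lemma seed_fits : ((hash_par n + 2 ^ hash_par n) *
  (copies_par n * (2 ^ hash_par n * (2 ^ hash_par n).+1)) <= long_seed n)%N.
Proof.
rewrite /long_seed (_ : 64 = 2 ^ 6)%N // -expnM (mulnC 6%N) expnM.
have := ltn_expl (hash_par n) (isT : (1 < 2)%N).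
have : (2 <= 2 ^ hash_par n)%N.
  by rewrite (leq_exp2l 1) // /hash_par -/k; have := k_ge11; lia.
move: (2 ^ hash_par n)%N => M M2 hM.
suff core : ((hash_par n + M) * (M * M.+1) <= M ^ 6)%N.
  by rewrite mulnCA [X in (_ <= X)%N]mulnC leq_mul2l core orbT.
apply: (@leq_trans (2 * M * (M * (2 * M)))%N).
  apply: leq_mul; first by lia.
  by apply: leq_mul; lia.
have M4 : (2 * 2 <= M * M)%N by rewrite leq_mul.
have -> : (M ^ 6 = M * M * (M * (M * M * M)))%N by rewrite !expnS expn0 muln1 !mulnA.
have -> : (2 * M * (M * (2 * M)) = 2 * 2 * (M * (M * M)))%N by lia.
apply: leq_mul => //; rewrite leq_mul2l; apply/orP; right.
by rewrite leq_pmulr //; lia.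
Qed.

(** The power of 64 is 2^(60k) and there are at most 2^(8k) q copies; q <= 2 log(1/eps) raises 68 k
    to at most 69 k, and k <= 2 L doubles 69. *)
Lemma long_seed_le : (long_seed n)%:R <= 2 `^ (138 * L) * log_inv (eps n).
Proof.
have l1 : 1 <= log_inv (eps n) by rewrite /log_inv le_max lexx.
have ql : q%:R <= 2 * log_inv (eps n).
  rewrite /q /err_par -natr1.
  have : (Num.truncn (log_inv (eps n)))%:R <= log_inv (eps n) by rewrite truncn_le; lra.
  lra.
have k11 := k_ge11.
have seed_q : (long_seed n <= 2 ^ (68 * k) * q)%N.
  have k2 : (k <= 2 ^ k)%N by rewrite ltnW // ltn_expl.
  have k12 : (k.+1 <= 2 ^ k)%N by rewrite ltn_expl.
  have q0 : (0 < q)%N by [].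
  have c_le : (copies_par n <= 16 * (2 ^ (4 * k) * q))%N.
    rewrite /copies_par -/k -/q -mul2n.
    have E : (k * k * k.+1 * 2 ^ k <= 2 ^ (4 * k))%N.
      have -> : (2 ^ (4 * k) = 2 ^ k * 2 ^ k * 2 ^ k * 2 ^ k)%N.
        by rewrite -!expnD; congr (_ ^ _)%N; lia.
      by rewrite !leq_mul.
    have E1 : (0 < 2 ^ (4 * k) * q)%N by rewrite muln_gt0 expn_gt0.
    have := leq_mul E (leqnn q).
    move: (2 ^ (4 * k) * q)%N E1 => A A0; move: (2 ^ k)%N => B H.
    have -> : (4 * k * k * (q * k.+1) * B = 4 * (k * k * k.+1 * B * q))%N by lia.
    lia.
  rewrite /long_seed /hash_par -/k (_ : 64 = 2 ^ 6)%N // -expnM.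
  have k16 : (16 <= 2 ^ (4 * k))%N by apply: (@leq_trans (2 ^ 4)%N) => //; rewrite leq_exp2l //; lia.
  apply: (@leq_trans (2 ^ (6 * (10 * k)) * (2 ^ (4 * k) * (2 ^ (4 * k) * q)))%N).
    by rewrite leq_mul2l (leq_trans c_le) ?orbT // leq_mul2r k16 orbT.
  rewrite !mulnA -!expnD leq_mul2r leq_exp2l //; apply/orP; right; lia.
apply: (@le_trans _ _ (2 `^ (69 * k)%:R * log_inv (eps n))); last first.
  apply: ler_wpM2r; first lra.
  apply: ler_powR; first by rewrite ler1n.
  by rewrite natrM; have := k_le; lra.
have := seed_q; rewrite -(ler_nat R) natrM => H; apply: le_trans H _.
rewrite powR2_nat.
apply: (@le_trans _ _ ((2 ^ (68 * k))%N%:R * (2 * log_inv (eps n)))).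
  by rewrite ler_wpM2l // ler0n.
rewrite mulrA ler_wpM2r //; first lra.
by rewrite -natrM ler_nat -expnSr leq_exp2l //; lia.
Qed.

Lemma seed_par_le : (seed_par n)%:R <= 2 `^ (138 * L) * log_inv (eps n).
Proof.
apply: le_trans long_seed_le; rewrite ler_nat /seed_par.
by case: ltnP.
Qed.

Lemma prg_fools : 0 < eps n -> fools (eps n) (@sparse_F2_poly n (S n)) (@prg n).
Proof.
move=> e0 f Sf; have [rn|nr] := ltnP (seed_par n) n; last first.
  have E : seed_par n = n by move: nr; rewrite /seed_par; case: ifP => // H; rewrite leqNgt H.
  have -> : uniform_expectation R (fun s => f (prg s)) = uniform_expectation R f.
    rewrite -(trunc_expectation f E); apply: (@eq_Ex R) => s; congr ((f _)%:R).
    by apply: eq_from_tnth => i; rewrite !tnth_mktuple ltnNge nr.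
  by rewrite subrr normr0 ltW.
have [fam [P [fam0 fE]]] := sparse_F2_polyE Sf.
have k11 := k_ge11.
have Qbig : (k * (4 * k * (q * k.+1) * 2 ^ k) <= copies_par n)%N.
  by rewrite /copies_par -/k -/q -muln2; lia.
have fits := seed_fits; rewrite -(long_seed_eq rn) in fits.
have := @fool_sparse R n (S n) k q (copies_par n) (seed_par n) (leq_trans (isT : (0 < 11)%N) k11) isT
  Qbig n_le S_le fits fam P fam0.
pose F y : R := sg R (F2_poly fam P y).
have E1 : Ex (fun x : bitstring n => sg R (f x)) = Ex F.
  rewrite -(Ex_bij F (to_cube_bij n)); apply: eq_Ex => x.
  by rewrite /F fE.
have E2 : Ex (fun s => sg R (f (prg s))) =
    Ex (fun s : cube 'I_(seed_par n) => F (gen_bits n k (copies_par n) s)).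
  rewrite -(Ex_bij _ (to_cube_bij (seed_par n))); apply: eq_Ex => s.
  rewrite /F fE; congr (sg R (F2_poly fam P _)); apply/ffunP => i.
  rewrite !ffunE tnth_mktuple rn; congr (out_bit _ _ _ _ _).
  by apply/funext => a; rewrite cube_fun_to_cube.
rewrite -/F -E1 -E2 => H.
rewrite !Ex_bool ?card_bitstring_gt0 //.
apply: le_trans (eps_gt e0).
apply: le_trans (dist_half_le _ _) _.
apply: le_trans H _.
(* By [k >= 11] the exponent absorbs the number of buckets and still leaves 2^-q, which is at most
   [eps n]. *)
have kt : (10 * k + 4 + q <= k * (q * k.+1))%N.
  have q0 : (0 < q)%N by [].
  have : (11 * q * 12 <= k * q * k.+1)%N by rewrite !leq_mul.
  have : (k * q * 12 <= k * q * k.+1)%N by rewrite !leq_mul.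
  have : (k * 1 <= k * q)%N by rewrite leq_mul.
  have : (11 * q <= k * q)%N by rewrite leq_mul.
  lia.
rewrite -(subnKC kt) -addnA mul_half.
by apply: half_anti; rewrite leq_addr.
Qed.

End Large.
End Instantiation.

Unset Implicit Arguments.

Theorem theorem2p2 (R : realType) :
  exists C : R, 0 < C /\
  forall (S : nat -> nat) (eps : nat -> R),
    little_omega (fun n => log2 (S n)%:R : R)
                 (fun n => log2 (log2 n%:R) ^+ 2) ->
    (forall n, 0 < eps n) ->
    exists (r : nat -> nat) (Gen : forall n, bitstring (r n) -> bitstring n),
      efficient_generator Gen /\
      \forall n \near \oo,
        (r n)%:R <= 2 `^ (C * Num.sqrt (log2 (S n)%:R))
                    * log_inv (eps n) /\
        fools (eps n) (sparse_F2_poly (S n)) (Gen n).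
Proof.
exists 138; split; first by rewrite ltr0n.
move=> S eps omega eps_gt0.
exists (seed_par S eps), (@prg R S eps); split; first exact: prg_efficient.
have omega1 := omega 1 ltr01.
near=> n.
have n_large : large R S n.
  split; last by rewrite -[leLHS]mul1r; near: n.
  have nbig : 2 `^ (2 `^ 10) < n%:R :> R by near: n; apply: nbhs_infty_gtr.
  have n0 : 0 < n%:R :> R by apply: lt_trans nbig; rewrite powR_gt0.
  have l0 : 2 `^ 10 <= log2 (n%:R : R) by rewrite log2_ge // ltW.
  by rewrite log2_ge //; apply: lt_le_trans l0; rewrite powR_gt0.
split; first exact: seed_par_le.
exact: prg_fools.
Unshelve. all: by end_near.
Qed.
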